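(* Let $G$ be a Lie group with a two-dimensional derived subalgebra, equipped with a left-invariant Riemannian metric $g$, and let $\tilde g$ be the lifted left-invariant metric on $TG$. Denote by $K$ and $\tilde K$ the sectional curvatures of $(G,g)$ and $(TG,\tilde g)$. (1) At each point, $(TG,\tilde g)$ has positive, negative and zero sectional curvatures. (2) For every orthonormal subset $\{u,v\}$ of $\mathcal P$: (I) $\tilde K(u^c,e_i^c)=\tilde K(u^c,e_i^v)=K(u,e_i)$ for $i=1,2$; (II) $\tilde K(e_1^c,e_2^c)=\tilde K(e_1^v,e_2^v)=K(e_1,e_2)$; (III) $\tilde K(u^c,v^c)=\tilde K(u^c,v^v)=K(u,v)$.
   Context: $G$ is a connected $n$-dimensional real Lie group with Lie algebra $\mathfrak g$ (left-invariant vector fields) such that $\mathfrak g'=[\mathfrak g,\mathfrak g]$ has dimension $2$ (equivalently, the commutator subgroup is two-dimensional). $g$ is a left-invariant Riemannian metric on $G$. $\{e_1,e_2\}$ is a $g$-orthonormal basis of $\mathfrak g'$ and $\mathcal P$ is the $(n-2)$-dimensional $g$-orthogonal complement of $\mathfrak g'$ in $\mathfrak g$. $TG$ is a Lie group with the tangent map $T\mu$ of the multiplication $\mu$ as product. For a vector field $X$ on $G$, the vertical lift $X^v$ is the infinitesimal generator on $TG$ of the flow $y\mapsto y+tX(x)$, $y\in T_xG$, and the complete lift $X^c$ is the infinitesimal generator of $T\phi_t$, where $\phi_t$ is the (local) flow of $X$. Lifts of left-invariant fields are left-invariant on $TG$, with $[X^c,Y^c]=[X,Y]^c$, $[X^c,Y^v]=[X,Y]^v$,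 $[X^v,Y^v]=0$. The lifted left-invariant metric $\tilde g$ on $TG$ is defined by $\tilde g(X^c,Y^c)=\tilde g(X^v,Y^v)=g(X,Y)$, $\tilde g(X^c,Y^v)=0$ for $X,Y\in\mathfrak g$. *)

(* Defs.v *)
From HB Require Import structures.
From mathcomp Require Import all_boot all_order all_algebra.
From mathcomp Require Import all_classical all_reals all_analysis.
Set Implicit Arguments.
Unset Strict Implicit.
Unset Printing Implicit Defensive.
Import Order.TTheory GRing.Theory Num.Theory.
Import numFieldNormedType.Exports.
Local Open Scope classical_set_scope.
Local Open Scope ring_scope.

(* Manifolds and Lie groups are not in the library.  A manifold is given by an
   atlas; functions, vector fields, connections and metrics are described
   through germs of smooth functions, so that the same definitions apply to G
   and to TG. *)

(* Functionals on functions M -> R: the type housing tangent vectors of M,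
   seen as derivations f |-> v f. *)
Notation functional R M := ((M -> R) -> R) (only parsing).
Notation vfield R M := (M -> functional R M) (only parsing).
Notation tensor2 R M := (M -> functional R M -> functional R M -> R)
  (only parsing).

Section SmoothFunctions.
Context {R : realType} {m : nat}.
Implicit Types (U : set 'rV[R]_m) (f : 'rV[R]_m -> R).

Fixpoint Ck U (k : nat) f : Prop :=
  match k with
  | 0 => forall x, U x -> {for x, continuous f}
  | k'.+1 => (forall x, U x -> differentiable f x) /\
             (forall v, Ck U k' (fun x => 'D_v f x))
  end.

Definition smooth_near (x : 'rV[R]_m) f : Prop :=
  exists U, [/\ open U, U x & forall k, Ck U k f].

End SmoothFunctions.

Record chart (R : realType) (m : nat) (M : Type) := Chart {
  dom : set M ;
  coord : M -> 'rV[R]_m }.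

Section Calculus.
Context {R : realType} {m : nat} {M : Type} (A : set (chart R m M)).
Implicit Types (p q : M) (f : M -> R) (u v w : functional R M).
Implicit Types (X Y Z : vfield R M).

(* neighbourhoods of p are pulled back along c, so that no topology on M is
   presupposed *)
Definition near_in (c : chart R m M) p (P : M -> Prop) : Prop :=
  \forall y \near coord c p, forall q, dom c q -> coord c q = y -> P q.

Definition near_pt p (P : M -> Prop) : Prop :=
  exists c, [/\ A c, dom c p & near_in c p P].

Definition represents (c : chart R m M) p f (F : 'rV[R]_m -> R) : Prop :=
  smooth_near (coord c p) F /\ near_in c p (fun q => f q = F (coord c q)).

Definition smooth_at p f : Prop :=
  exists c F, [/\ A c, dom c p & represents c p f F].

Definition smooth f : Prop := forall p, smooth_at p f.

(* v = \sum_i xi_i d/dx_i at p in some chart x; on functions which are not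
   smooth at p, v is normalized to 0, so that a tangent vector is determined
   by its action on germs. *)
Definition tangent p v : Prop :=
  exists c (xi : 'rV[R]_m), [/\ A c, dom c p,
    forall f F, represents c p f F -> v f = 'D_xi F (coord c p) &
    forall f, ~ smooth_at p f -> v f = 0].

Definition vector_field X : Prop :=
  (forall p, tangent p (X p)) /\
  (forall p f, smooth_at p f -> smooth_at p (fun q => X q f)).

Definition bracket X Y : vfield R M := fun p f =>
  if `[< smooth_at p f >]
  then X p (fun q => Y q f) - Y p (fun q => X q f) else 0.

Definition has_velocity (gam : R -> M) v : Prop :=
  forall f, smooth_at (gam 0) f -> is_derive (0 : R) (1 : R) (f \o gam) (v f).

Definition riemannian (g : tensor2 R M) : Prop :=
  [/\ forall p a u v w, tangent p u -> tangent p v -> tangent p w ->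
        g p (a *: u + v) w = a * g p u w + g p v w,
      forall p v w, tangent p v -> tangent p w -> g p v w = g p w v,
      forall p v, tangent p v -> v <> 0 -> 0 < g p v v &
      forall X Y, vector_field X -> vector_field Y ->
        smooth (fun p => g p (X p) (Y p))].

Definition connection (nabla : vfield R M -> vfield R M -> vfield R M) : Prop :=
  [/\ forall X Y, vector_field X -> vector_field Y ->
        vector_field (nabla X Y),
      forall h X X' Y, smooth h ->
        vector_field X -> vector_field X' -> vector_field Y ->
        nabla (fun p => h p *: X p + X' p) Y =
        (fun p => h p *: nabla X Y p + nabla X' Y p) &
      forall h X Y Y', smooth h ->
        vector_field X -> vector_field Y -> vector_field Y' ->
        nabla X (fun p => h p *: Y p + Y' p) =
        (fun p => X p h *: Y p + h p *: nabla X Y p + nabla X Y' p)].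

Definition levi_civita g nabla : Prop :=
  [/\ connection nabla,
      forall X Y, vector_field X -> vector_field Y ->
        nabla X Y - nabla Y X = bracket X Y &
      forall X Y Z p, vector_field X -> vector_field Y -> vector_field Z ->
        X p (fun q => g q (Y q) (Z q)) =
        g p (nabla X Y p) (Z p) + g p (Y p) (nabla X Z p)].

Definition curvature (nabla : vfield R M -> vfield R M -> vfield R M) X Y Z :
    vfield R M :=
  nabla X (nabla Y Z) - nabla Y (nabla X Z) - nabla (bracket X Y) Z.

(* The curvature is tensorial, so this depends only on the plane spanned by
   X p and Y p; it is meaningful only when X p and Y p are independent. *)
Definition sec (g : tensor2 R M) nabla X Y p : R :=
  g p (curvature nabla X Y Y p) (X p) /
  (g p (X p) (X p) * g p (Y p) (Y p) - g p (X p) (Y p) ^+ 2).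

Definition sectional_curvatures g nabla p : set R :=
  [set k | exists X Y,
    [/\ vector_field X, vector_field Y,
        (forall s t : R, s *: X p + t *: Y p = 0 -> s = 0 /\ t = 0) &
        k = sec g nabla X Y p]].

End Calculus.

Section SmoothMaps.
Context {R : realType}.

(* A map is smooth when it pulls germs of smooth functions back to germs of
   smooth functions; continuity follows, since the indicator function of a
   neighbourhood of h p is smooth at h p. *)
Definition smooth_map_at {m n : nat} {M N : Type} (A : set (chart R m M))
    (B : set (chart R n N)) (h : M -> N) (p : M) : Prop :=
  forall f, smooth_at B (h p) f -> smooth_at A p (f \o h).

Definition tangent_map {n : nat} {M N : Type} (B : set (chart R n N))
    (h : M -> N) (p : M) (v : functional R M) : functional R N :=
  fun f => if `[< smooth_at B (h p) f >] then v (f \o h) else 0.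

Definition prod_atlas {m n : nat} {M N : Type} (A : set (chart R m M))
    (B : set (chart R n N)) : set (chart R (m + n) (M * N)) :=
  [set c | exists a b, [/\ A a, B b &
    c = Chart (dom a `*` dom b) (fun x => row_mx (coord a x.1) (coord b x.2))]].

Definition line_atlas : set (chart R 1 R) :=
  [set Chart setT (fun t : R => \row_(i < 1) t)].

Definition local_flow {m : nat} {M : Type} (A : set (chart R m M))
    (X : vfield R M) (p : M) (phi : R -> M -> M) : Prop :=
  [/\ smooth_map_at (prod_atlas line_atlas A) A (fun x => phi x.1 x.2) (0, p),
      near_pt A p (fun q => phi 0 q = q) &
      near_pt (prod_atlas line_atlas A) (0, p) (fun x => forall f,
        smooth_at A (phi x.1 x.2) f ->
        is_derive x.1 (1 : R) (fun s => f (phi s x.2)) (X (phi x.1 x.2) f))].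

End SmoothMaps.

Section TangentBundle.
Context {R : realType} {m : nat} {M : Type} (A : set (chart R m M)).

Record tbundle := TangentVector {
  foot : M ;
  vec : functional R M ;
  vec_tangent : tangent A foot vec }.

HB.instance Definition _ := gen_eqMixin tbundle.
HB.instance Definition _ := gen_choiceMixin tbundle.

Definition tbundle_atlas : set (chart R (m + m) tbundle) :=
  [set c | exists2 a, A a &
    c = Chart [set x | dom a (foot x)]
          (fun x => row_mx (coord a (foot x))
                      (\row_(i < m) vec x (fun q => coord a q ord0 i)))].

(* infinitesimal generator of y |-> y + t X(foot y) *)
Definition vertical_lift (X : vfield R M) (V : vfield R tbundle) : Prop :=
  vector_field tbundle_atlas V /\
  forall y, exists2 gam : R -> tbundle,
    forall t, foot (gam t) = foot y /\ vec (gam t) = vec y + t *: X (foot y) &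
    has_velocity tbundle_atlas gam (V y).

(* infinitesimal generator of T phi_t, for phi the local flow of X *)
Definition complete_lift (X : vfield R M) (C : vfield R tbundle) : Prop :=
  vector_field tbundle_atlas C /\
  forall y, exists phi : R -> M -> M, local_flow A X (foot y) phi /\
  exists2 gam : R -> tbundle,
    \forall t \near (0 : R), foot (gam t) = phi t (foot y) /\
      vec (gam t) = tangent_map A (phi t) (foot y) (vec y) &
    has_velocity tbundle_atlas gam (C y).

End TangentBundle.
Arguments tbundle_atlas {R m M} A.
Arguments vertical_lift {R m M} A.
Arguments complete_lift {R m M} A.

(* The charts of A are homeomorphisms from open sets of M onto open sets of
   R^n, with smooth transition functions. *)
Definition manifold {R : realType} {n : nat} {M : topologicalType}
    (A : set (chart R n M)) : Prop :=
  [/\ hausdorff_space M, @second_countable M,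
      forall p, exists2 c, A c & dom c p,
      forall c, A c ->
        [/\ open (dom c), {in dom c &, injective (coord c)},
            (forall p, dom c p -> {for p, continuous (coord c)}) &
            forall O, open O -> O `<=` dom c -> open (coord c @` O)] &
      forall c d p, A c -> A d -> dom c p -> dom d p -> forall i,
        exists F, represents c p (fun q => coord d q ord0 i) F].

HB.mixin Record isLieGroup (R : realType) (n : nat) G
    of Topological G & Group G := {
  atlas : set (chart R n G) ;
  atlas_manifold : manifold atlas ;
  smooth_mulg : forall x : G * G,
    smooth_map_at (prod_atlas atlas atlas) atlas (fun y => (y.1 * y.2)%g) x ;
  smooth_invg : forall x : G, smooth_map_at atlas atlas (fun y => y^-1%g) x }.

#[short(type="lieGroupType")]
HB.structure Definition LieGroup (R : realType) (n : nat) :=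
  {G of isLieGroup R n G & Topological G & Group G}.

Section LieGroups.
Context {R : realType} {n : nat} (G : lieGroupType R n).
Local Notation A := (atlas : set (chart R n G)).
Local Notation TG := (tbundle A).
Implicit Types (X Y Z : vfield R G).
Implicit Types (g : tensor2 R G).

Definition lie_algebra : set (vfield R G) :=
  [set X | vector_field A X /\
    forall x y, X (x * y)%g = tangent_map A (fun z => (x * z)%g) y (X y)].

Definition derived_algebra : set (vfield R G) :=
  [set Z | exists k (a : 'I_k -> R) (X Y : 'I_k -> vfield R G),
    (forall i, lie_algebra (X i) /\ lie_algebra (Y i)) /\
    Z = \sum_(i < k) a i *: bracket A (X i) (Y i)].

(* the product T mu of TG: T mu (v, w) = T R_q v + T L_p w for v in T_p G and
   w in T_q G; the set below is a singleton, hence the default value y is never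
   used *)
Definition tmul (y z : TG) : TG :=
  xget y [set t : TG | foot t = (foot y * foot z)%g /\
    vec t = tangent_map A (fun x => (x * foot z)%g) (foot y) (vec y)
          + tangent_map A (fun x => (foot y * x)%g) (foot z) (vec z)].

(* for left-invariant g, X and Y, the function p |-> g p (X p) (Y p) is
   constant; g(X, Y) is read at the identity *)
Definition inner g X Y : R := g 1%g (X 1%g) (Y 1%g).

Definition lifted_metric g (cl vl : vfield R G -> vfield R TG)
    (gt : tensor2 R TG) : Prop :=
  forall X Y y, lie_algebra X -> lie_algebra Y ->
    [/\ gt y (cl X y) (cl Y y) = inner g X Y,
        gt y (vl X y) (vl Y y) = inner g X Y &
        gt y (cl X y) (vl Y y) = 0].

Definition orthogonal_complement g (S : set (vfield R G)) : set (vfield R G) :=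
  [set X | lie_algebra X /\ forall Z, S Z -> inner g X Z = 0].

Definition orthonormal_pair g X Y : Prop :=
  [/\ inner g X X = 1, inner g Y Y = 1 & inner g X Y = 0].

End LieGroups.
Arguments lie_algebra {R n} G.
Arguments derived_algebra {R n} G.

Definition left_invariant_metric {R : realType} {m : nat} {M : Type}
    (A : set (chart R m M)) (op : M -> M -> M)
    (h : tensor2 R M) : Prop :=
  forall x y v w, tangent A y v -> tangent A y w ->
    h (op x y) (tangent_map A (op x) y v) (tangent_map A (op x) y w) = h y v w.

Definition basis_of_set {R : realType} {V : lmodType R} (k : nat)
    (S : set V) (e : 'I_k -> V) : Prop :=
  [/\ forall i, S (e i),
      forall a : 'I_k -> R, \sum_(i < k) a i *: e i = 0 -> forall i, a i = 0 &
      forall z, S z -> exists a : 'I_k -> R, z = \sum_(i < k) a i *: e i].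

Definition has_dimension {R : realType} {V : lmodType R} (k : nat)
    (S : set V) : Prop := exists e : 'I_k -> V, basis_of_set S e.

(* Main.v *)
From mathcomp Require Import all_boot all_order all_algebra.
From mathcomp Require Import all_classical all_reals all_analysis.
From mathcomp Require Import ring lra.
Require Import Defs.
Set Implicit Arguments.
Unset Strict Implicit.
Unset Printing Implicit Defensive.
Import Order.TTheory GRing.Theory Num.Theory.
Import numFieldNormedType.Exports.
Local Open Scope classical_set_scope.
Local Open Scope ring_scope.

(** The curvature of a left-invariant metric is algebra: Koszul's formula
    expresses the inner products of the Levi-Civita derivatives of left-invariant
    fields by their brackets, and the numerator of a sectional curvature is
      - <D_Y Y, D_X X> + <D_X Y, D_Y X> - <D_[X,Y] Y, X>
    ([curvature_inner]).  On TG the lifts of left-invariant fields satisfy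
    [Xc, Yc] = [X, Y]c, [Xc, Yv] = [X, Y]v and [Xv, Yv] = 0, and span the tangent
    spaces ([lift_span]), so that the same formulas determine the derivatives of
    lifts.  Let u be orthogonal to the derived algebra g'.  Then the inner
    products of u with brackets vanish, and for all Y and all X
      D_Xc Yc = (D_X Y)c,  D_uc Yv = (D_u Y)v,  D_Yv uc = (D_Y u)v,
      D_Xv Yv = (D_X Y)c if [X, Y] = 0.
    Inserted in the formula for the numerator, these give
      R~(Xc, Yc) = R(X, Y),  R~(uc, Yv) = R(u, Y),
      R~(Xv, Yv) = R(X, Y) if [X, Y] = 0,
    which contains all the equalities of curvatures once [e1, e2] = 0 is known.
    The latter holds because [ad] of a commutator is traceless on g', whereas the
    traces of [ad e1] and [ad e2] on the plane g' are, up to sign, the coordinates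
    of [e1, e2] ([derived_abelian]).

    For the signs, some u orthogonal to g' is not central, since otherwise g',
    being abelian, would vanish ([exists_noncentral]).  Take Y with
    E = [Y, u] nonzero.  As D_u u = 0, the numerators of the three planes
    (uc, uv), (Yc, uv) and (uv, Ev) are 0, -3/4 |E|^2 and the square norm of
    D_uv Ev; this vector is not zero, for its inner product with Yc is |E|^2 / 2.

    The bracket relations of the lifts have to be derived from their definition
    by flows.  The coordinates of TG are of the two forms f o foot and
    vec ^~ f, and a complete lift Xc sends the latter to vec ^~ (X f): the
    derivative in time of f composed with the flow of X commutes with the
    derivation by a vector of G ([complete_lift_vec], through the symmetry of
    second derivatives [smooth_near_schwarz]).  That left-invariant fields and
    their lifts span the tangent spaces rests on the joint smoothness of the
    product ([left_translates_lie]). *)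

(** * Derivatives in coordinates *)

Section Differentiability.
Context {R : realType}.

Lemma near_eq_differentiable (V W : normedModType R) (f g : V -> W) (x : V) :
  (\near x, f x = g x) -> differentiable f x -> differentiable g x.
Proof.
move=> fg /diff_locallyP [dc df].
have gE : g \o shift x = cst (g x) + 'd f x +o_ 0 id.
  have fgh : \forall h \near 0, f (h + x) = g (h + x).
    have H := fg; rewrite (near_shift 0) in H; near=> h.
    have : ((fun y => f y = g y) \o shift (x - 0)) h by near: h.
    by rewrite /= subr0.
  apply/eqaddoP => e e0; move/eqaddoP: df => /(_ _ e0) df; near=> h.
  have E : (g \o shift x - (cst (g x) + 'd f x)) h =
           (f \o shift x - (cst (f x) + 'd f x)) h.
    rewrite !fctE /= (nbhs_singleton fg); congr (_ - _).
    by symmetry; near: h.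
  by rewrite E; near: h.
apply/diff_locallyP; rewrite (diff_unique dc gE); split => //.
Unshelve. all: by end_near. Qed.

Lemma differentiable_rV (V : normedModType R) n (H : V -> 'rV[R]_n) (x : V) :
  (forall i, differentiable (fun y => H y ord0 i) x) -> differentiable H x.
Proof.
move=> dH.
rewrite (_ : H = \sum_(i < n) (fun y => H y ord0 i *: delta_mx ord0 i)).
  apply: differentiable_sum => i.
  exact: (@differentiableZl _ _ _ (fun y => H y ord0 i)).
by apply/funext => y; rewrite fct_sumE {1}(row_sum_delta (H y)).
Qed.

Lemma derive_rV (V : normedModType R) n (H : V -> 'rV[R]_n) (x v : V) :
  differentiable H x ->
  'D_v H x = \row_i 'D_v (fun y => H y ord0 i) x.
Proof.
move=> dH; rewrite derive_mx; last exact: diff_derivable.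
by apply/rowP => i; rewrite !mxE.
Qed.

Lemma derive_sum_delta n (F : 'rV[R]_n -> R) (x v : 'rV[R]_n) :
  differentiable F x ->
  'D_v F x = \sum_(i < n) v ord0 i * 'D_(delta_mx ord0 i) F x.
Proof.
move=> dF; rewrite deriveE // {1}(row_sum_delta v) linear_sum.
by apply: eq_bigr => i _; rewrite linearZ /= deriveE.
Qed.

Lemma derive_comp m n (F : 'rV[R]_n -> R) (H : 'rV[R]_m -> 'rV[R]_n)
    (x v : 'rV[R]_m) :
  differentiable H x -> differentiable F (H x) ->
  'D_v (F \o H) x = 'D_('D_v H x) F (H x).
Proof.
move=> dH dF; rewrite (deriveE _ (differentiable_comp dH dF)).
by rewrite (deriveE _ dF) (deriveE _ dH) diff_comp.
Qed.

Lemma derive_linear_comb (V W : normedModType R) (f : V -> W) (x v w : V) (a : R) :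
  differentiable f x -> 'D_(a *: v + w) f x = a *: 'D_v f x + 'D_w f x.
Proof. by move=> df; rewrite !deriveE // linearP. Qed.

End Differentiability.

(** * Smooth functions on open sets *)

Section Ck.
Context {R : realType} {m : nat}.
Implicit Types (U V : set 'rV[R]_m) (f g : 'rV[R]_m -> R) (x v : 'rV[R]_m).

Lemma Ck_subset U V k f : V `<=` U -> Ck U k f -> Ck V k f.
Proof.
move=> VU; elim: k f => [|k IH] f /=; first by move=> fc x /VU/fc.
by move=> [df dk]; split => [x /VU/df|v] //; exact: IH.
Qed.

Lemma open_near U x (P : 'rV[R]_m -> Prop) :
  open U -> U x -> (forall y, U y -> P y) -> \forall y \near x, P y.
Proof.
by move=> oU Ux UP; apply: filterS (open_nbhs_nbhs (conj oU Ux)) => y /UP.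
Qed.

Lemma Ck_eq U k f g : open U -> (forall x, U x -> f x = g x) ->
  Ck U k f -> Ck U k g.
Proof.
move=> oU; elim: k f g => [|k IH] f g fg /=.
  move=> fc x Ux; rewrite /prop_for /continuous_at -fg //.
  apply: (cvg_trans _ (fc x Ux)).
  exact: near_eq_cvg (@open_near _ _ (fun y => f y = g y) oU Ux fg).
move=> [df dk]; split=> [x Ux|v].
  exact: near_eq_differentiable (open_near oU Ux fg) (df x Ux).
apply: IH (dk v) => x Ux; exact: near_eq_derive (open_near oU Ux fg).
Qed.

Lemma Ck_pred U k f : Ck U k.+1 f -> Ck U k f.
Proof.
elim: k f => [|k IH] f /= [df dk].
  by move=> x Ux; exact/differentiable_continuous/df.
by split => // v; apply: IH; exact: dk.
Qed.

Lemma Ck_cst U k (a : R) : Ck U k (cst a).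
Proof.
elim: k a => [|k IH] a /=; first by move=> x _; exact: cst_continuous.
split => // v; rewrite (_ : (fun x => _) = cst 0); first exact: IH.
by apply/funext => x; rewrite derive_cst.
Qed.

Lemma CkD U k f g : open U -> Ck U k f -> Ck U k g -> Ck U k (f \+ g).
Proof.
move=> oU; elim: k f g => [|k IH] f g /=.
  by move=> fc gc x Ux; apply: continuousD; [exact: fc|exact: gc].
move=> [df fk] [dg gk]; split=> [x Ux|v].
  by apply: differentiableD; [exact: df|exact: dg].
apply: (Ck_eq oU) (IH _ _ (fk v) (gk v)) => x Ux /=.
by rewrite deriveD //; apply: diff_derivable; [exact: df|exact: dg].
Qed.

Lemma CkM U k f g : open U -> Ck U k f -> Ck U k g -> Ck U k (f \* g).
Proof.
move=> oU; elim: k f g => [|k IH] f g.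
  by move=> fc gc x Ux; apply: continuousM; [exact: fc|exact: gc].
move=> fk1 gk1; have [df fk] := fk1; have [dg gk] := gk1; split=> [x Ux|v].
  by apply: differentiableM; [exact: df|exact: dg].
have H := CkD oU (IH _ _ (Ck_pred fk1) (gk v)) (IH _ _ (Ck_pred gk1) (fk v)).
apply: (Ck_eq oU) H => x Ux /=.
by rewrite deriveM //; apply: diff_derivable; [exact: df|exact: dg].
Qed.

Lemma Ck_sum U k n (f : 'I_n -> 'rV[R]_m -> R) : open U ->
  (forall i, Ck U k (f i)) -> Ck U k (fun x => \sum_(i < n) f i x).
Proof.
move=> oU; elim: n f => [|n IH] f fk.
  apply: (Ck_eq oU) (Ck_cst _ _ 0) => x _; by rewrite big_ord0.
apply: (Ck_eq oU) (CkD oU (fk ord0) (IH _ (fun i => fk (lift ord0 i)))) => x _.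
by rewrite big_ord_recl.
Qed.

Lemma Ck_coord U k i : Ck U k (fun x => x ord0 i).
Proof.
case: k => [|k] /=; first by move=> x _; exact: coord_continuous.
split=> [x _|v]; first exact: differentiable_coord.
rewrite (_ : (fun x => _) = cst (v ord0 i)); first exact: Ck_cst.
apply/funext => x.
by have := derive_rV v (@differentiable_rV _ _ _ id x (fun i => differentiable_coord x ord0 i));
  rewrite derive_id => /rowP/(_ i); rewrite mxE.
Qed.

End Ck.

Lemma cvg_rV (R : realType) n (T : Type) (F : set_system T) {FF : Filter F}
    (H : T -> 'rV[R]_n) (l : 'rV[R]_n) :
  (forall i, H y ord0 i @[y --> F] --> l ord0 i) -> H y @[y --> F] --> l.
Proof.
move=> Hc; apply/cvgrPdist_lt => e e0; near=> y.
rewrite /Num.Def.normr/= mx_normrE; apply/bigmax_ltP; split => // -[i j] _.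
rewrite !mxE /= !ord1; move: j {i}; near: y; apply: filter_forall => j.
exact: ((cvgrPdist_lt _ _).1 (Hc j)).
Unshelve. all: by end_near. Qed.

(** By the chain rule a derivative of [F \o H] is a sum of products of
    derivatives of F along H with derivatives of the coordinates of H, so the
    order of differentiability is gained one step at a time. *)
Lemma Ck_comp (R : realType) m n (U : set 'rV[R]_m) (V : set 'rV[R]_n) k
    (F : 'rV[R]_n -> R) (H : 'rV[R]_m -> 'rV[R]_n) : open U ->
  (forall x, U x -> V (H x)) -> (forall i, Ck U k (fun x => H x ord0 i)) ->
  Ck V k F -> Ck U k (F \o H).
Proof.
move=> oU UV; elim: k F => [|k IH] F Hk Fk.
  move=> x Ux; apply: continuous_comp; last exact/Fk/UV.
  exact: (@cvg_rV _ _ _ (nbhs x) _ _ _ (fun i => Hk i x Ux)).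
have dH x : U x -> differentiable H x.
  by move=> Ux; apply: differentiable_rV => i; have [+ _] := Hk i; exact.
have dF x : U x -> differentiable F (H x) by move=> /UV; have [+ _] := Fk; exact.
split=> [x Ux|v]; first exact: differentiable_comp (dH x Ux) (dF x Ux).
pose G i := (fun x => 'D_(delta_mx ord0 i) F (H x))
         \* (fun x => 'D_v (fun y => H y ord0 i) x).
apply: (@Ck_eq _ _ _ _ (fun x => \sum_(i < n) G i x)) => //.
  move=> x Ux; rewrite derive_comp; [|exact: dH|exact: dF].
  rewrite derive_sum_delta; last exact: dF.
  rewrite derive_rV; last exact: dH.
  by apply: eq_bigr => i _; rewrite mxE mulrC.
apply: Ck_sum => // i; apply: CkM => //; last by have [_ +] := Hk i; exact.
apply: (IH (fun y => 'D_(delta_mx ord0 i) F y)); last by have [_ +] := Fk; exact.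
by move=> j; exact: Ck_pred.
Unshelve. all: by end_near. Qed.

Section SmoothNear.
Context {R : realType} {m : nat}.
Implicit Types (f g : 'rV[R]_m -> R) (x v : 'rV[R]_m).

Lemma smooth_near_eq x f g :
  (\near x, f x = g x) -> smooth_near x f -> smooth_near x g.
Proof.
rewrite -nbhs_nearE nbhsE => -[V [oV Vx] fg] [U [oU Ux fk]].
exists (U `&` V); split => //; first exact: openI.
move=> k; apply: (@Ck_eq _ _ _ _ f); first exact: openI.
  by move=> y [_ /fg].
exact: Ck_subset (@subIsetl _ _ _) (fk k).
Qed.

Lemma near_smooth_near x f :
  smooth_near x f -> \forall y \near x, smooth_near y f.
Proof. by move=> [U [oU Ux fk]]; apply: (open_near oU Ux) => y Uy; exists U. Qed.

Lemma smooth_near_differentiable x f : smooth_near x f -> differentiable f x.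
Proof. by move=> [U [oU Ux /(_ 1)]] [+ _]; exact. Qed.

Lemma smooth_near_continuous x f : smooth_near x f -> {for x, continuous f}.
Proof. by move=> /smooth_near_differentiable/differentiable_continuous. Qed.

Lemma smooth_near_derive x v f : smooth_near x f -> smooth_near x ('D_v f).
Proof.
by move=> [U [oU Ux fk]]; exists U; split => // k; have [_ +] := fk k.+1; exact.
Qed.

Lemma smooth_near_cst x (a : R) : smooth_near x (cst a).
Proof. by exists setT; split => //; [exact: openT|move=> k; exact: Ck_cst]. Qed.

Lemma smooth_near_coord x i : smooth_near x (fun y => y ord0 i).
Proof. by exists setT; split => //; [exact: openT|move=> k; exact: Ck_coord]. Qed.

Lemma smooth_nearD x f g :
  smooth_near x f -> smooth_near x g -> smooth_near x (f \+ g).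
Proof.
move=> [U [oU Ux fk]] [V [oV Vx gk]]; exists (U `&` V).
have oUV := openI oU oV; split => // k; apply: CkD => //.
- exact: Ck_subset (@subIsetl _ _ _) (fk k).
- exact: Ck_subset (@subIsetr _ _ _) (gk k).
Qed.

Lemma smooth_nearM x f g :
  smooth_near x f -> smooth_near x g -> smooth_near x (f \* g).
Proof.
move=> [U [oU Ux fk]] [V [oV Vx gk]]; exists (U `&` V).
have oUV := openI oU oV; split => // k; apply: CkM => //.
- exact: Ck_subset (@subIsetl _ _ _) (fk k).
- exact: Ck_subset (@subIsetr _ _ _) (gk k).
Qed.

Lemma smooth_near_sum x n (f : 'I_n -> 'rV[R]_m -> R) :
  (forall i, smooth_near x (f i)) ->
  smooth_near x (fun y => \sum_(i < n) f i y).
Proof.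
elim: n f => [|n IH] f fk.
  apply: (@smooth_near_eq _ (cst 0)); last exact: smooth_near_cst.
  by near=> y; rewrite big_ord0.
apply: (@smooth_near_eq _ (f ord0 \+ (fun y => \sum_(i < n) f (lift ord0 i) y))).
  by near=> y; rewrite big_ord_recl.
by apply: smooth_nearD => //; exact: IH.
Unshelve. all: by end_near. Qed.

End SmoothNear.

Section SmoothComp.
Context {R : realType} {m n : nat}.
Implicit Types (F : 'rV[R]_n -> R) (H : 'rV[R]_m -> 'rV[R]_n) (x v : 'rV[R]_m).

Lemma smooth_coords_differentiable x H :
  (forall i, smooth_near x (fun y => H y ord0 i)) -> differentiable H x.
Proof.
by move=> sH; apply: differentiable_rV => i; exact: smooth_near_differentiable.
Qed.

Lemma smooth_coords_continuous x H :
  (forall i, smooth_near x (fun y => H y ord0 i)) -> {for x, continuous H}.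
Proof.
by move=> sH; apply: differentiable_continuous; exact: smooth_coords_differentiable.
Qed.

(** The neighbourhoods on which the coordinates of H are smooth and on which H
    stays where F is smooth are shrunk to one open set, as smoothness near a
    point asks for a single neighbourhood serving all orders. *)
Lemma smooth_near_comp x F H :
  (forall i, smooth_near x (fun y => H y ord0 i)) ->
  smooth_near (H x) F -> smooth_near x (F \o H).
Proof.
move=> sH [V [oV VHx Fk]].
have [W [oW Wx HW]] : exists W, [/\ open W, W x &
    forall y, W y -> V (H y) /\ forall i k, Ck W k (fun y => H y ord0 i)].
  have /choice [U HU] : forall i, exists U, [/\ open U, U x &
      forall k, Ck U k (fun y => H y ord0 i)] by exact: sH.
  have : \forall y \near x, V (H y) /\ forall i, U i y.
    near=> y; split.
      near: y; apply: (smooth_coords_continuous sH).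
      exact: open_nbhs_nbhs.
    near: y; apply: filter_forall => i; have [oU Ux _] := HU i.
    exact: open_nbhs_nbhs.
  rewrite -nbhs_nearE nbhsE => -[W [oW Wx] HW]; exists W; split => // y Wy.
  have [VHy _] := HW y Wy; split => // i k; have [_ _ /(_ k)] := HU i.
  by apply: Ck_subset => z /HW[_]; exact.
have Ck_H i k : Ck W k (fun y => H y ord0 i) by exact: (HW x Wx).2.
exists W; split => // k; apply: (Ck_comp oW) (Fk k) => //.
by move=> y /HW[].
Unshelve. all: by end_near. Qed.

End SmoothComp.

(** * Symmetry of second derivatives *)

Lemma filter_and3 (T : Type) (F : set_system T) (FF : Filter F)
    (P Q S : T -> Prop) :
  (\forall x \near F, P x) -> (\forall x \near F, Q x) ->
  (\forall x \near F, S x) -> \forall x \near F, [/\ P x, Q x & S x].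
Proof. exact: filterS3. Qed.

Lemma dist_le_half (R : realFieldType) (a b c e : R) :
  `|a - c| < e / 2 -> `|b - c| < e / 2 -> `|a - b| <= e.
Proof.
rewrite !ltr_norml => /andP[a1 a2] /andP[b1 b2].
by rewrite ler_norml; apply/andP; split; lra.
Qed.

Section Schwarz.
Context {R : realType} {m : nat}.
Implicit Types (f : 'rV[R]_m -> R) (x v w : 'rV[R]_m).

Lemma is_derive_line f x v (s d : R) :
  is_derive (x + s *: v) v f d ->
  is_derive s (1 : R) (fun t => f (x + t *: v)) d.
Proof.
move=> [df dE].
have E : (fun h => h^-1 *: (((fun t => f (x + t *: v)) \o shift s) (h *: (1 : R))
            - f (x + s *: v))) =
         (fun h => h^-1 *: ((f \o shift (x + s *: v)) (h *: v) - f (x + s *: v))).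
  apply/funext => h /=; congr (_ *: (f _ - _)).
  by rewrite /GRing.scale /= mulr1 -/(GRing.scale _ _) scalerDl addrCA.
split; first by rewrite /derivable E.
by rewrite /derive E.
Qed.

Lemma derive_translate f x v a :
  'D_v (fun y => f (y + a)) x = 'D_v f (x + a).
Proof.
rewrite /derive (_ : (fun h => _) =
  (fun h => h^-1 *: ((f \o shift (x + a)) (h *: v) - f (x + a)))) //.
by apply/funext => k /=; rewrite addrA.
Qed.

Lemma MVT_line f x v (h : R) : 0 < h ->
  (forall s, 0 <= s <= h -> differentiable f (x + s *: v)) ->
  exists2 s, 0 <= s <= h & f (x + h *: v) - f x = h * 'D_v f (x + s *: v).
Proof.
move=> h0 df.
have dg s : 0 <= s <= h ->
    is_derive s (1 : R) (fun t => f (x + t *: v)) ('D_v f (x + s *: v)).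
  by move=> /df dfs; apply: is_derive_line; split => //; exact: diff_derivable.
have dgi s : s \in `[0, h]%R ->
    is_derive s (1 : R) (fun t => f (x + t *: v)) ('D_v f (x + s *: v)).
  by rewrite in_itv; exact: dg.
have [s sh E] := @MVT R (fun t => f (x + t *: v)) (fun t => 'D_v f (x + t *: v))
  0 h h0 (fun t th => dgi t (subset_itv_oo_cc th))
  (derivable_within_continuous (fun t th => @ex_derive _ _ _ _ _ _ _ (dgi t th))).
exists s; first by have := subset_itv_oo_cc sh; rewrite in_itv.
by move: E; rewrite scale0r addr0 subr0 mulrC.
Qed.

(** The mean value theorem, applied along v to [f (y + h *: w) - f y] and then
    along w to ['D_v f]. *)
Lemma second_difference f x v w (h : R) : 0 < h ->
  (forall s t, 0 <= s <= h -> 0 <= t <= h ->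
     smooth_near (x + s *: v + t *: w) f) ->
  exists s t, [/\ 0 <= s <= h, 0 <= t <= h &
    f (x + h *: v + h *: w) - f (x + h *: v) - f (x + h *: w) + f x =
    h * (h * 'D_w ('D_v f) (x + s *: v + t *: w))].
Proof.
move=> h0 sf; have hh : 0 <= h <= h by rewrite lexx ltW.
have oh : 0 <= (0 : R) <= h by rewrite lexx ltW.
pose F y := f (y + h *: w) - f y.
have sF s : 0 <= s <= h -> differentiable (fun y => f (y + h *: w)) (x + s *: v)
    /\ differentiable f (x + s *: v).
  move=> sh; split; last first.
    by apply: smooth_near_differentiable; have := sf s 0 sh oh; rewrite scale0r addr0.
  apply: (@differentiable_comp _ _ _ _ (fun y => y + h *: w) f).
    exact: differentiableD.
  exact/smooth_near_differentiable/sf.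
have dF s : 0 <= s <= h -> differentiable F (x + s *: v).
  by move=> /sF[? ?]; exact: differentiableB.
have [s sh E] := MVT_line h0 dF.
have [t th E2] := @MVT_line ('D_v f) (x + s *: v) w h h0
  (fun t th => smooth_near_differentiable (smooth_near_derive v (sf s t sh th))).
exists s, t; split => //; rewrite -E2.
have -> : 'D_v f (x + s *: v + h *: w) - 'D_v f (x + s *: v) = 'D_v F (x + s *: v).
  have [d1 d2] := sF _ sh.
  rewrite (_ : F = (fun y => f (y + h *: w)) - f) //.
  have e1 : derivable (fun y => f (y + h *: w)) (x + s *: v) v by exact: diff_derivable.
  have e2 : derivable f (x + s *: v) v by exact: diff_derivable.
  rewrite (deriveB e1 e2).
  by rewrite derive_translate.
by rewrite -E /F; ring.
Qed.

(** The second difference of f over a small parallelogram is symmetric in v and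
    w, so the two mixed derivatives take a common value at two points
    arbitrarily close to x; both are continuous at x. *)
Lemma smooth_near_schwarz f x v w :
  smooth_near x f -> 'D_w ('D_v f) x = 'D_v ('D_w f) x.
Proof.
move=> sf; apply/eqP; rewrite -subr_eq0 -normr_eq0; apply/eqP/le_anti.
rewrite normr_ge0 andbT; apply/ler_addgt0Pl => e e0; rewrite addr0.
have e2 : 0 < e / 2 by rewrite divr_gt0.
have c1 := smooth_near_continuous (smooth_near_derive w (smooth_near_derive v sf)).
have c2 := smooth_near_continuous (smooth_near_derive v (smooth_near_derive w sf)).
have : \forall y \near x, [/\ smooth_near y f,
     `|'D_w ('D_v f) x - 'D_w ('D_v f) y| < e / 2 &
     `|'D_v ('D_w f) x - 'D_v ('D_w f) y| < e / 2].
  exact: filter_and3 (near_smooth_near sf)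
    ((cvgrPdist_lt _ _).1 c1 _ e2) ((cvgrPdist_lt _ _).1 c2 _ e2).
move/nbhs_ballP => [d /= d0 Hd].
(* h is such that parallelograms of sides at most h *: v and h *: w stay in the
   ball of radius d; the 1 keeps C positive when v = w = 0 *)
pose C := `|v| + `|w| + 1.
have C0 : 0 < C by rewrite ltr_wpDl // addr_ge0.
pose h := d / (2 * C).
have h0 : 0 < h by rewrite divr_gt0 // mulr_gt0.
have near_h v' w' s t : `|v'| + `|w'| <= `|v| + `|w| ->
    0 <= s <= h -> 0 <= t <= h -> ball x d (x + s *: v' + t *: w').
  move=> vw /andP[s0 sh] /andP[t0 th]; rewrite -ball_normE /=.
  rewrite !opprD addrA [x + _]addrA subrr sub0r -opprD normrN.
  apply: le_lt_trans (ler_normD _ _) _; rewrite !normrZ !ger0_norm //.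
  apply: (@le_lt_trans _ _ (h * C)).
    apply: le_trans (lerD (ler_wpM2r (normr_ge0 _) sh) (ler_wpM2r (normr_ge0 _) th)) _.
    by rewrite -mulrDr ler_wpM2l ?(ltW h0) // (le_trans vw) // lerDl.
  rewrite /h -mulrA invfM -mulrA mulVf ?gt_eqF // mulr1 gtr_pMr //.
  by rewrite invf_lt1 // ltr1n.
have [s [t [sh th E]]] := second_difference h0
  (fun s t sh th => let: And3 a _ _ := Hd _ (near_h v w s t (lexx _) sh th) in a).
have wv : `|w| + `|v| <= `|v| + `|w| by rewrite addrC.
have [t' [s' [th' sh' E']]] := second_difference h0
  (fun s t sh th => let: And3 a _ _ := Hd _ (near_h w v s t wv sh th) in a).
have [_ H1 _] := Hd _ (near_h v w s t (lexx _) sh th).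
have [_ _ H2] := Hd _ (near_h w v t' s' wv th' sh').
have EE : 'D_w ('D_v f) (x + s *: v + t *: w) =
          'D_v ('D_w f) (x + t' *: w + s' *: v).
  apply: (mulfI (lt0r_neq0 h0)); apply: (mulfI (lt0r_neq0 h0)).
  apply: etrans (esym E) (etrans _ E').
  rewrite -[x + h *: w + _]addrA [h *: w + _]addrC addrA.
  by rewrite (addrAC (f (x + h *: v + h *: w))).
rewrite -EE in H2.
exact: dist_le_half H1 H2.
Qed.

End Schwarz.

(** * Germs, smooth atlases and tangent vectors *)

Section NearIn.
Context {R : realType} {m : nat} {M : Type}.
Implicit Types (c : chart R m M) (p : M) (P Q : M -> Prop).

Lemma near_in_impl c p P (S : 'rV[R]_m -> Prop) :
  (\forall y \near coord c p, S y) ->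
  (forall q, dom c q -> S (coord c q) -> P q) -> near_in c p P.
Proof.
move=> nS SP; rewrite /near_in; near=> y => q cq E; apply: SP => //.
by rewrite E; near: y.
Unshelve. all: by end_near. Qed.

Lemma near_inS c p P Q : (forall q, P q -> Q q) -> near_in c p P -> near_in c p Q.
Proof. by move=> PQ nP; apply: (near_in_impl nP) => q cq /(_ q cq erefl)/PQ. Qed.

Lemma near_inI c p P Q : near_in c p P -> near_in c p Q ->
  near_in c p (fun q => P q /\ Q q).
Proof.
rewrite /near_in => nP nQ; near=> y => q cq E.
by split; move: q cq E; near: y.
Unshelve. all: by end_near. Qed.

Lemma near_in_self c p P : dom c p -> near_in c p P -> P p.
Proof. by move=> dp /nbhs_singleton; exact. Qed.

Lemma near_in_near c p P : near_in c p P -> near_in c p (fun q => near_in c q P).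
Proof.
by move=> /near_join nP; apply: (near_in_impl nP).
Qed.

Lemma near_in_coord c p (O : set 'rV[R]_m) :
  (\forall y \near coord c p, O y) -> near_in c p (fun q => O (coord c q)).
Proof.
by move=> nO; exact: (near_in_impl nO).
Qed.

Lemma near_in_dom c p : near_in c p (dom c).
Proof. by rewrite /near_in; near=> y. Unshelve. all: by end_near. Qed.

Lemma near_inW c p P : (forall q, P q) -> near_in c p P.
Proof. by move=> HP; rewrite /near_in; near=> y. Unshelve. all: by end_near. Qed.

End NearIn.

Section Atlas.
Context {R : realType} {m : nat} {M : Type}.

(** The part of the manifold structure on which the calculus rests: domains are
    open and coordinate changes are smooth, both expressed through germs, so
    that it makes sense for the tangent bundle, which carries no topology. *)
Definition smooth_atlas (A : set (chart R m M)) : Prop :=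
  (forall p, exists2 c, A c & dom c p) /\
  forall c d p, A c -> A d -> dom c p -> dom d p ->
    near_in c p (dom d) /\
    forall i, exists F, represents c p (fun q => coord d q ord0 i) F.

Context (A : set (chart R m M)) (sA : smooth_atlas A).
Implicit Types (c d : chart R m M) (p q : M) (f g : M -> R).
Implicit Types (u v w : functional R M) (X Y Z : vfield R M).

Lemma atlas_cover p : exists2 c, A c & dom c p.
Proof. by case: sA => + _; exact. Qed.

(** A change of coordinates as one map H, assembled from the germs of its
    components; all comparisons of charts below go through it. *)
Lemma coord_change c d p : A c -> A d -> dom c p -> dom d p ->
  exists H : 'rV[R]_m -> 'rV[R]_m, [/\ H (coord c p) = coord d p,
    forall i, smooth_near (coord c p) (fun y => H y ord0 i) &
    near_in c p (fun q => dom d q /\ coord d q = H (coord c q))].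
Proof.
move=> Ac Ad cp dp; have [_ /(_ c d p Ac Ad cp dp) [nd /choice [F HF]]] := sA.
pose H y := \row_i F i y : 'rV[R]_m.
have HE i : (fun y => H y ord0 i) = F i by apply/funext => y; rewrite mxE.
have nE : near_in c p (fun q => dom d q /\ coord d q = H (coord c q)).
  apply: near_inI => //.
  have : \forall y \near coord c p, forall i, forall q, dom c q ->
      coord c q = y -> coord d q ord0 i = F i (coord c q).
    by near=> y; near: y; apply: filter_forall => i; have [_] := HF i; exact.
  move=> nF; apply: (near_in_impl nF) => q cq HH.
  by apply/rowP => i; rewrite mxE; exact: HH.
exists H; split => //.
- by have [_ ->] := near_in_self cp nE.
- by move=> i; rewrite HE; have [] := HF i.
Unshelve. all: by end_near. Qed.

Lemma near_in_change c d p (P : M -> Prop) : A c -> A d -> dom c p -> dom d p ->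
  near_in d p P -> near_in c p P.
Proof.
move=> Ac Ad cp dp nP; have [H [Hp sH nE]] := coord_change Ac Ad cp dp.
have cH := smooth_coords_continuous sH.
rewrite /near_in -Hp in nP; have {}nP := cH _ nP.
apply: near_inS (near_inI (near_in_coord nP) nE) => q [HP [dq E]].
exact: HP.
Qed.

Lemma near_pt_in c p (P : M -> Prop) : A c -> dom c p ->
  near_pt A p P -> near_in c p P.
Proof. by move=> Ac cp [d [Ad dp]]; exact: near_in_change. Qed.

Lemma represents_eq c p f g F : near_in c p (fun q => f q = g q) ->
  represents c p f F -> represents c p g F.
Proof.
move=> fg [sF fF]; split => //.
by apply: near_inS (near_inI fg fF) => q [-> ->].
Qed.

Lemma represents_near c p f F : represents c p f F ->
  near_in c p (fun q => represents c q f F).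
Proof.
move=> [sF fF]; apply: near_inS (near_inI (near_in_coord (near_smooth_near sF))
  (near_in_near fF)) => q [a b]; split => //.
Qed.

Lemma represents_coord c p i :
  represents c p (fun q => coord c q ord0 i) (fun y => y ord0 i).
Proof. by split; [exact: smooth_near_coord|exact: near_inW]. Qed.

Lemma represents_cst c p (a : R) : represents c p (cst a) (cst a).
Proof. by split; [exact: smooth_near_cst|exact: near_inW]. Qed.

Lemma representsD c p f g F G : represents c p f F -> represents c p g G ->
  represents c p (f \+ g) (F \+ G).
Proof.
move=> [sF fF] [sG gG]; split; first exact: smooth_nearD.
by apply: near_inS (near_inI fF gG) => q /= [-> ->].
Qed.

Lemma representsM c p f g F G : represents c p f F -> represents c p g G ->
  represents c p (f \* g) (F \* G).
Proof.
move=> [sF fF] [sG gG]; split; first exact: smooth_nearM.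
by apply: near_inS (near_inI fF gG) => q /= [-> ->].
Qed.

Lemma represents_change c d p f F (H : 'rV[R]_m -> 'rV[R]_m) :
  A c -> A d -> dom c p -> dom d p ->
  H (coord c p) = coord d p ->
  (forall i, smooth_near (coord c p) (fun y => H y ord0 i)) ->
  near_in c p (fun q => dom d q /\ coord d q = H (coord c q)) ->
  represents d p f F -> represents c p f (F \o H).
Proof.
move=> Ac Ad cp dp Hp sH nE [sF fF]; split.
  by apply: smooth_near_comp => //; rewrite Hp.
apply: near_inS (near_inI nE (near_in_change Ac Ad cp dp fF)) => q [[_ E] ->] /=.
by rewrite E.
Qed.

Lemma smooth_at_in c p f : A c -> dom c p -> smooth_at A p f ->
  exists F, represents c p f F.
Proof.
move=> Ac cp [d [F [Ad dp rF]]]; have [H [Hp sH nE]] := coord_change Ac Ad cp dp.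
by exists (F \o H); exact: represents_change rF.
Qed.

Lemma smooth_at_eq p f g : near_pt A p (fun q => f q = g q) ->
  smooth_at A p f -> smooth_at A p g.
Proof.
move=> fg [c [F [Ac cp rF]]]; exists c, F; split => //.
by apply: represents_eq rF; exact: near_pt_in.
Qed.

Lemma smooth_at_near p f : smooth_at A p f -> near_pt A p (fun q => smooth_at A q f).
Proof.
move=> [c [F [Ac cp rF]]]; exists c; split => //.
apply: near_inS (near_inI (near_in_dom c p) (represents_near rF)) => q [cq rq].
by exists c, F.
Qed.

Lemma smooth_at_cst p (a : R) : smooth_at A p (cst a).
Proof.
have [c Ac cp] := atlas_cover p; exists c, (cst a); split => //.
exact: represents_cst.
Qed.

Lemma smooth_atD p f g : smooth_at A p f -> smooth_at A p g ->
  smooth_at A p (f \+ g).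
Proof.
move=> [c [F [Ac cp rF]]] /(smooth_at_in Ac cp) [G rG].
by exists c, (F \+ G); split => //; exact: representsD.
Qed.

Lemma smooth_atM p f g : smooth_at A p f -> smooth_at A p g ->
  smooth_at A p (f \* g).
Proof.
move=> [c [F [Ac cp rF]]] /(smooth_at_in Ac cp) [G rG].
by exists c, (F \* G); split => //; exact: representsM.
Qed.

Lemma smooth_at_coord c p i : A c -> dom c p ->
  smooth_at A p (fun q => coord c q ord0 i).
Proof. by move=> Ac cp; exists c, (fun y => y ord0 i); split => //; exact: represents_coord. Qed.

Lemma near_ptS p (P Q : M -> Prop) : (forall q, P q -> Q q) ->
  near_pt A p P -> near_pt A p Q.
Proof. by move=> PQ [c [Ac cp nP]]; exists c; split => //; exact: near_inS nP. Qed.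

Lemma near_pt_self p (P : M -> Prop) : near_pt A p P -> P p.
Proof. by move=> [c [Ac cp /(near_in_self cp)]]. Qed.

Lemma tangent_nonsmooth p v f : tangent A p v -> ~ smooth_at A p f -> v f = 0.
Proof. by move=> [c [xi [_ _ _ +]]]; exact. Qed.

Lemma tangent_in c p v : A c -> dom c p -> tangent A p v ->
  exists xi, forall f F, represents c p f F -> v f = 'D_xi F (coord c p).
Proof.
move=> Ac cp [d [xi [Ad dp Hv _]]].
have [H [Hp sH nE]] := coord_change Ad Ac dp cp.
exists ('D_xi H (coord d p)) => f F rF.
rewrite (Hv _ _ (represents_change Ad Ac dp cp Hp sH nE rF)).
have [sF _] := rF.
rewrite derive_comp ?Hp //; first exact: smooth_coords_differentiable.
exact: smooth_near_differentiable.
Qed.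

(** The components of v in the chart c, which v takes on the coordinates of c
    because these are represented by linear functions. *)
Definition components c v : 'rV[R]_m := \row_i v (fun q => coord c q ord0 i).

(** The chart c need not be the one in which v is presented: a change of
    coordinates turns v into a derivation in c, and the coordinates of c reveal
    in which direction. *)
Lemma tangent_components c p v f F : A c -> dom c p -> tangent A p v ->
  represents c p f F -> v f = 'D_(components c v) F (coord c p).
Proof.
move=> Ac cp tv rF; have [xi Hxi] := tangent_in Ac cp tv.
rewrite (Hxi _ _ rF); congr ('D_ _ F _); apply/rowP => i; rewrite mxE.
rewrite (Hxi _ _ (represents_coord c p i)).
have := @derive_rV _ _ _ id (coord c p) xi (differentiable_rV
   (fun i => differentiable_coord (coord c p) ord0 i)).
by rewrite derive_id => /rowP/(_ i); rewrite mxE.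
Qed.

Lemma tangent_build c p v xi : A c -> dom c p ->
  (forall f F, represents c p f F -> v f = 'D_xi F (coord c p)) ->
  (forall f, ~ smooth_at A p f -> v f = 0) -> tangent A p v.
Proof. by move=> Ac cp Hv H0; exists c, xi. Qed.

Lemma tangent_eq c p v w : A c -> dom c p -> tangent A p v -> tangent A p w ->
  (forall i, v (fun q => coord c q ord0 i) = w (fun q => coord c q ord0 i)) ->
  v = w.
Proof.
move=> Ac cp tv tw vw; apply/funext => f.
case: (pselect (smooth_at A p f)) => sf; last first.
  by rewrite (tangent_nonsmooth tv sf) (tangent_nonsmooth tw sf).
have [F rF] := smooth_at_in Ac cp sf.
rewrite (tangent_components Ac cp tv rF) (tangent_components Ac cp tw rF).
by congr ('D_ _ F _); apply/rowP => i; rewrite !mxE.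
Qed.

(** On non-smooth functions both values are 0, since smoothness at p is itself a
    property of germs. *)
Lemma tangent_local p v f g : tangent A p v ->
  near_pt A p (fun q => f q = g q) -> v f = v g.
Proof.
move=> tv fg.
have gf : near_pt A p (fun q => g q = f q) by apply: near_ptS fg.
case: (pselect (smooth_at A p f)) => sf; last first.
  rewrite (tangent_nonsmooth tv sf) (tangent_nonsmooth tv) //.
  by move=> sg; apply: sf; exact: smooth_at_eq sg.
have [c Ac cp] := atlas_cover p.
have [F rF] := smooth_at_in Ac cp sf.
have rG := represents_eq (near_pt_in Ac cp fg) rF.
by rewrite (tangent_components Ac cp tv rF) (tangent_components Ac cp tv rG).
Qed.

Lemma tangent_comb p (a : R) v w : tangent A p v -> tangent A p w ->
  tangent A p (a *: v + w).
Proof.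
move=> tv tw; have [c Ac cp] := atlas_cover p.
apply: (@tangent_build c p _ (a *: components c v + components c w)) => //.
  move=> f F rF; have [sF _] := rF.
  rewrite derive_linear_comb; last exact: smooth_near_differentiable.
  by rewrite -(tangent_components Ac cp tv rF) -(tangent_components Ac cp tw rF).
move=> f sf; rewrite /= !fctE (tangent_nonsmooth tv sf) (tangent_nonsmooth tw sf).
by rewrite scaler0 addr0.
Qed.

Lemma tangent_fcomb p (a : R) v f g : tangent A p v ->
  smooth_at A p f -> smooth_at A p g ->
  v (fun q => a * f q + g q) = a * v f + v g.
Proof.
move=> tv sf sg; have [c Ac cp] := atlas_cover p.
have [F rF] := smooth_at_in Ac cp sf; have [G rG] := smooth_at_in Ac cp sg.
have rH := representsD (representsM (represents_cst c p a) rF) rG.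
rewrite (tangent_components Ac cp tv rH) (tangent_components Ac cp tv rF)
  (tangent_components Ac cp tv rG).
have [/smooth_near_differentiable dF _] := rF.
have [/smooth_near_differentiable dG _] := rG.
have daF : differentiable (a *: F) (coord c p) by exact: differentiableZ.
rewrite (_ : _ \+ _ = a *: F + G) //.
by rewrite deriveD ?deriveZ //; exact: diff_derivable.
Qed.

Lemma tangent_cst p v (a : R) : tangent A p v -> v (cst a) = 0.
Proof.
move=> tv; have [c Ac cp] := atlas_cover p.
by rewrite (tangent_components Ac cp tv (represents_cst c p a)) derive_cst.
Qed.

Lemma vector_field_comb (a : R) X Y : vector_field A X -> vector_field A Y ->
  vector_field A (a *: X + Y).
Proof.
move=> [tX sX] [tY sY]; split=> [p|p f sf]; first exact: tangent_comb.
exact: smooth_atD (smooth_atM (smooth_at_cst p a) (sX p f sf)) (sY p f sf).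
Qed.

End Atlas.

(** * Manifolds and smooth maps *)

Section Manifold.
Context {R : realType} {n : nat} {M : topologicalType} (A : set (chart R n M)).
Hypothesis mA : manifold A.

(** The image under a chart of the common part of two domains is open, which is
    what a neighbourhood in coordinates requires. *)
Lemma manifold_smooth_atlas : smooth_atlas A.
Proof.
have [_ _ cov ch tr] := mA; split => // c d p Ac Ad cp dp; split; last exact: tr.
have [oc ic _ oi] := ch c Ac; have [od _ _ _] := ch d Ad.
have oO : open (coord c @` (dom c `&` dom d)).
  by apply: oi; [exact: openI|exact: subIsetl].
have nO : nbhs (coord c p) (coord c @` (dom c `&` dom d)).
  by apply: open_nbhs_nbhs; split => //; exists p.
apply: (near_in_impl nO) => q cq [r [cr dr] E].
by rewrite -(ic r q) ?in_setE.
Qed.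

(** The image of a chart is open, so that a function determines near the point
    the function of coordinates representing it, hence its derivatives. *)
Lemma tangent_exists c p (xi : 'rV[R]_n) : A c -> dom c p ->
  exists v, tangent A p v /\
    forall f F, represents c p f F -> v f = 'D_xi F (coord c p).
Proof.
move=> Ac cp; have sA := manifold_smooth_atlas.
have [_ _ _ ch _] := mA; have [oc _ _ oi] := ch c Ac.
have nO : nbhs (coord c p) (coord c @` dom c).
  by apply: open_nbhs_nbhs; split; [exact: oi|exists p].
pose v f := if pselect (exists F, represents c p f F) is left e
            then 'D_xi (projT1 (cid e)) (coord c p) else 0.
have vE f F : represents c p f F -> v f = 'D_xi F (coord c p).
  rewrite /v; case: pselect => [e|ne] rF; last by case: ne; exists F.
  have [_ nF] := rF; have [_ nG] := projT2 (cid e).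
  apply: near_eq_derive; near=> y.
  have [q cq E] : (coord c @` dom c) y by near: y.
  have Fy : forall q, dom c q -> coord c q = y -> f q = F (coord c q).
    by near: y; exact: nF.
  have Gy : forall q, dom c q -> coord c q = y ->
      f q = projT1 (cid e) (coord c q) by near: y; exact: nG.
  by rewrite -E -(Fy q cq E) -(Gy q cq E).
exists v; split => //; apply: (tangent_build Ac cp vE) => f sf.
rewrite /v; case: pselect => // -[F rF]; case: sf.
by exists c, F.
Unshelve. all: by end_near. Qed.

End Manifold.

Section SmoothMapAt.
Context {R : realType} {m n : nat} {M N : Type}.
Context (A : set (chart R m M)) (B : set (chart R n N)).
Context (sA : smooth_atlas A) (sB : smooth_atlas B).
Implicit Types (h : M -> N) (p : M).

(** Continuity of smooth maps: the indicator function of a neighbourhood of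
    [h p] is smooth at [h p], and its pull-back, being continuous at [p], cannot
    jump from 1 to 0. *)
Lemma smooth_map_near h p (P : N -> Prop) : smooth_map_at A B h p ->
  near_pt B (h p) P -> near_pt A p (P \o h).
Proof.
move=> sh nP; pose f q : R := if `[< P q >] then 1 else 0.
have [d Bd dp] := atlas_cover sB (h p).
have sf : smooth_at B (h p) f.
  apply: (@smooth_at_eq _ _ _ _ sB _ (cst 1)); last exact: smooth_at_cst.
  by apply: near_ptS nP => q Pq; rewrite /f; case: asboolP.
have [c [F [Ac cp [sF nF]]]] := sh f sf.
have F1 : F (coord c p) = 1.
  rewrite -(near_in_self cp nF) /= /f; case: asboolP => // np.
  by case: np; exact: near_pt_self nP.
have F0 : \forall y \near coord c p, 0 < F y.
  have cF := smooth_near_continuous sF.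
  apply: (cF [set x | 0 < x]); rewrite F1.
  by apply: open_nbhs_nbhs; split => //=; exact: open_gt.
exists c; split => //; apply: near_inS (near_inI nF (near_in_coord F0)) => q [].
rewrite /= /f; case: asboolP => // _ <-; by rewrite ltxx.
Qed.

Lemma tangent_mapE h p v f : smooth_at B (h p) f ->
  tangent_map B h p v f = v (f \o h).
Proof. by move=> sf; rewrite /tangent_map; case: asboolP. Qed.

Lemma tangent_map_tangent h p v : smooth_map_at A B h p -> tangent A p v ->
  tangent B (h p) (tangent_map B h p v).
Proof.
move=> sh tv; have [c Ac cp] := atlas_cover sA p.
have [d Bd dp] := atlas_cover sB (h p).
have /choice [H HH] : forall i, exists F,
    represents c p ((fun q => coord d q ord0 i) \o h) F.
  by move=> i; apply: (smooth_at_in sA) => //; apply/sh/smooth_at_coord.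
pose K y := \row_i H i y : 'rV[R]_n.
have KE i : (fun y => K y ord0 i) = H i by apply/funext => y; rewrite mxE.
have sK i : smooth_near (coord c p) (fun y => K y ord0 i).
  by rewrite KE; have [] := HH i.
have nK : near_in c p (fun q => coord d (h q) = K (coord c q)).
  have : \forall y \near coord c p, forall i, forall q, dom c q ->
      coord c q = y -> coord d (h q) ord0 i = H i (coord c q).
    by near=> y; near: y; apply: filter_forall => i; have [_] := HH i; exact.
  move=> nF; apply: (near_in_impl nF) => q cq E.
  by apply/rowP => i; rewrite mxE; exact: E.
have Kp : K (coord c p) = coord d (h p) by rewrite (near_in_self cp nK).
apply: (@tangent_build _ _ _ _ d _ _ ('D_(components c v) K (coord c p))) => //.
  move=> f F rF; rewrite tangent_mapE; last by exists d, F.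
  have [sF nF] := rF.
  have rFK : represents c p (f \o h) (F \o K).
    split; first by apply: smooth_near_comp => //; rewrite Kp.
    have nF' : near_pt B (h p) (fun q => f q = F (coord d q)) by exists d.
    have := near_pt_in sA Ac cp (smooth_map_near sh nF') => n1.
    by apply: near_inS (near_inI n1 nK) => q [/= -> ->].
  rewrite (tangent_components sA Ac cp tv rFK) derive_comp ?Kp //.
    exact: smooth_coords_differentiable.
  exact: smooth_near_differentiable.
by move=> f sf; rewrite /tangent_map; case: asboolP.
Unshelve. all: by end_near. Qed.

End SmoothMapAt.

Section RowMx.
Context {R : realType} {m n : nat}.
Implicit Types (x : 'rV[R]_m) (y : 'rV[R]_n) (F : 'rV[R]_(m + n) -> R).

Lemma smooth_near_row_mxl x y i :
  smooth_near x (fun x' => row_mx x' y ord0 i).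
Proof.
case: (split_ordP i) => j ->.
  under eq_fun do rewrite row_mxEl; exact: smooth_near_coord.
under eq_fun do rewrite row_mxEr; exact: smooth_near_cst.
Qed.

Lemma smooth_near_row_mxr x y i :
  smooth_near y (fun y' => row_mx x y' ord0 i).
Proof.
case: (split_ordP i) => j ->.
  under eq_fun do rewrite row_mxEl; exact: smooth_near_cst.
under eq_fun do rewrite row_mxEr; exact: smooth_near_coord.
Qed.

(** A neighbourhood of (x, y) gives iterated neighbourhoods, in which x' is
    chosen before y'; this is the form in which conditions near a point of a
    product are used. *)
Lemma near_row_mx x y (S : 'rV[R]_(m + n) -> Prop) :
  (\forall z \near row_mx x y, S z) ->
  \forall x' \near x, \forall y' \near y, S (row_mx x' y').
Proof.
move=> /near_join nS.
have c1 := smooth_coords_continuous (smooth_near_row_mxl x y).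
have nS1 := c1 _ nS; near=> x'.
have nS2 : \forall z \near row_mx x' y, S z by near: x'.
have c2 := smooth_coords_continuous (smooth_near_row_mxr x' y).
exact: (c2 _ nS2).
Unshelve. all: by end_near. Qed.

Lemma smooth_near_slicel x y F : smooth_near (row_mx x y) F ->
  smooth_near x (fun x' => F (row_mx x' y)).
Proof.
move=> sF; apply: (@smooth_near_comp _ _ _ x F (fun x' => row_mx x' y)) => // i.
exact: smooth_near_row_mxl.
Qed.

Lemma smooth_near_slicer x y F : smooth_near (row_mx x y) F ->
  smooth_near y (fun y' => F (row_mx x y')).
Proof.
move=> sF; apply: (@smooth_near_comp _ _ _ y F (fun y' => row_mx x y')) => // i.
exact: smooth_near_row_mxr.
Qed.

Lemma derive_slicer x y v F :
  'D_v (fun y' => F (row_mx x y')) y = 'D_(row_mx 0 v) F (row_mx x y).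
Proof.
rewrite /derive (_ : (fun h => _) = (fun h => h^-1 *:
  ((F \o shift (row_mx x y)) (h *: row_mx 0 v) - F (row_mx x y)))) //.
by apply/funext => h /=; rewrite scale_row_mx add_row_mx scaler0 add0r.
Qed.

Lemma smooth_near_lsubmx (z : 'rV[R]_(m + n)) (F : 'rV[R]_m -> R) :
  smooth_near (lsubmx z) F -> smooth_near z (F \o lsubmx).
Proof.
apply: smooth_near_comp => i.
under eq_fun do rewrite mxE; exact: smooth_near_coord.
Qed.

Lemma smooth_near_rsubmx (z : 'rV[R]_(m + n)) (F : 'rV[R]_n -> R) :
  smooth_near (rsubmx z) F -> smooth_near z (F \o rsubmx).
Proof.
apply: smooth_near_comp => i.
under eq_fun do rewrite mxE; exact: smooth_near_coord.
Qed.

End RowMx.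

(** * Atlases of products and of the tangent bundle *)

Section Product.
Context {R : realType} {m n : nat} {M N : Type}.
Context (A : set (chart R m M)) (B : set (chart R n N)).
Context (sA : smooth_atlas A) (sB : smooth_atlas B).

Definition prod_chart (a : chart R m M) (b : chart R n N) : chart R (m + n) (M * N) :=
  Chart (dom a `*` dom b) (fun x => row_mx (coord a x.1) (coord b x.2)).

Lemma near_in_prodl a b p q (P : M -> Prop) :
  near_in a p P -> near_in (prod_chart a b) (p, q) (P \o fst).
Proof.
move=> nP.
have cl : {for row_mx (coord a p) (coord b q),
    continuous (lsubmx : 'rV[R]_(m + n) -> 'rV[R]_m)}.
  exact/differentiable_continuous/differentiable_lsubmx.
rewrite /near_in -[coord a p](row_mxKl _ (coord b q)) in nP.
have nP' : \forall z \near row_mx (coord a p) (coord b q), forall p',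
    dom a p' -> coord a p' = lsubmx z -> P p' by exact: (cl _ nP).
apply: (@near_in_impl _ _ _ (prod_chart a b) (p, q) _ _ nP') => -[p' q'] [/= ap' bq'] H.
by apply: H => //; rewrite row_mxKl.
Qed.

Lemma near_in_prodr a b p q (P : N -> Prop) :
  near_in b q P -> near_in (prod_chart a b) (p, q) (P \o snd).
Proof.
move=> nP.
have cl : {for row_mx (coord a p) (coord b q),
    continuous (rsubmx : 'rV[R]_(m + n) -> 'rV[R]_n)}.
  exact/differentiable_continuous/differentiable_rsubmx.
rewrite /near_in -[coord b q](row_mxKr (coord a p) _) in nP.
have nP' : \forall z \near row_mx (coord a p) (coord b q), forall q',
    dom b q' -> coord b q' = rsubmx z -> P q' by exact: (cl _ nP).
apply: (@near_in_impl _ _ _ (prod_chart a b) (p, q) _ _ nP') => -[p' q'] [/= ap' bq'] H.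
by apply: H => //; rewrite row_mxKr.
Qed.

Lemma represents_prodl a b p q f F :
  represents a p f F -> represents (prod_chart a b) (p, q) (f \o fst) (F \o lsubmx).
Proof.
move=> [sF nF]; split; first by apply: smooth_near_lsubmx; rewrite row_mxKl.
by apply: near_inS (near_in_prodl b q nF) => -[p' q'] /= ->; rewrite row_mxKl.
Qed.

Lemma represents_prodr a b p q f F :
  represents b q f F -> represents (prod_chart a b) (p, q) (f \o snd) (F \o rsubmx).
Proof.
move=> [sF nF]; split; first by apply: smooth_near_rsubmx; rewrite row_mxKr.
by apply: near_inS (near_in_prodr a p nF) => -[p' q'] /= ->; rewrite row_mxKr.
Qed.

Lemma prod_smooth_atlas : smooth_atlas (prod_atlas A B).
Proof.
split=> [[p q]|].
  have [a Aa ap] := atlas_cover sA p; have [b Bb bq] := atlas_cover sB q.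
  by exists (prod_chart a b) => //; exists a, b.
move=> _ _ [p q] [a [b [Aa Bb ->]]] [a' [b' [Aa' Bb' ->]]] [ap bq] [a'p b'q].
have [_ chA] := sA; have [_ chB] := sB.
have [na ra] := chA a a' p Aa Aa' ap a'p.
have [nb rb] := chB b b' q Bb Bb' bq b'q.
split; first by apply: near_inI; [exact: near_in_prodl|exact: near_in_prodr].
move=> i; case: (split_ordP i) => j ->.
  have [F rF] := ra j; exists (F \o lsubmx).
  apply: (represents_eq _ (represents_prodl b q rF)).
  by apply: near_inW => x /=; rewrite row_mxEl.
have [F rF] := rb j; exists (F \o rsubmx).
apply: (represents_eq _ (represents_prodr a p rF)).
by apply: near_inW => x /=; rewrite row_mxEr.
Qed.

Lemma near_in_prod a b p q (P : M -> N -> Prop) :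
  near_in (prod_chart a b) (p, q) (fun x => P x.1 x.2) ->
  near_in a p (fun p' => near_in b q (fun q' => P p' q')).
Proof.
move=> /near_row_mx nP; apply: (near_in_impl nP) => p' ap' nP'.
by apply: (near_in_impl nP') => q' bq' /(_ (p', q')); apply.
Qed.

End Product.

Lemma line_smooth_atlas (R : realType) : smooth_atlas (@line_atlas R).
Proof.
split=> [p|_ _ p -> -> _ _]; first by exists (Chart setT (fun t : R => \row_(i < 1) t)).
split; first exact: near_inW.
by move=> i; exists (fun y => y ord0 i); exact: represents_coord.
Qed.

Section TangentBundleAtlas.
Context {R : realType} {m : nat} {M : Type} (A : set (chart R m M)).
Context (sA : smooth_atlas A).
Local Notation TM := (tbundle A).
Local Notation TA := (tbundle_atlas A).
Implicit Types (a : chart R m M) (y z : TM) (f : M -> R).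

Lemma tbundle_eq y z : foot y = foot z -> vec y = vec z -> y = z.
Proof.
case: y z => [p v tv] [q w tw] /= pq vw; rewrite pq vw in tv *.
by congr TangentVector; exact: Prop_irrelevance.
Qed.

Definition tchart a : chart R (m + m) TM :=
  Chart [set x | dom a (foot x)]
    (fun x => row_mx (coord a (foot x)) (components a (vec x))).

Lemma tbundle_atlasE a : A a -> TA (tchart a).
Proof. by move=> Aa; exists a. Qed.

Lemma near_in_foot a y (P : M -> Prop) :
  near_in a (foot y) P -> near_in (tchart a) y (P \o @foot _ _ _ A).
Proof.
move=> nP.
have cl : {for row_mx (coord a (foot y)) (components a (vec y)),
    continuous (lsubmx : 'rV[R]_(m + m) -> 'rV[R]_m)}.
  exact/differentiable_continuous/differentiable_lsubmx.
rewrite /near_in -[coord a _](row_mxKl _ (components a (vec y))) in nP.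
have nP' : \forall w \near row_mx (coord a (foot y)) (components a (vec y)),
    forall p, dom a p -> coord a p = lsubmx w -> P p by exact: (cl _ nP).
apply: (@near_in_impl _ _ _ (tchart a) y _ _ nP') => z /= az H.
by apply: H => //; rewrite row_mxKl.
Qed.

Lemma near_pt_foot y (P : M -> Prop) :
  near_pt A (foot y) P -> near_pt TA y (P \o @foot _ _ _ A).
Proof.
move=> [a [Aa ay nP]]; exists (tchart a); split => //; first exact: tbundle_atlasE.
exact: near_in_foot.
Qed.

Lemma represents_foot a y f F : represents a (foot y) f F ->
  represents (tchart a) y (f \o @foot _ _ _ A) (F \o lsubmx).
Proof.
move=> [sF nF]; split; first by apply: smooth_near_lsubmx; rewrite row_mxKl.
by apply: near_inS (near_in_foot nF) => z /= ->; rewrite row_mxKl.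
Qed.

(** In the coordinates (x, xi) of TM, the differential of f is the function
    that sends (x, xi) to the sum of the [xi_i * dF/dx_i]. *)
Lemma represents_vec a y f F : A a -> dom a (foot y) -> represents a (foot y) f F ->
  represents (tchart a) y (fun z => vec z f)
   (fun w => \sum_(i < m) rsubmx w ord0 i * 'D_(delta_mx ord0 i) F (lsubmx w)).
Proof.
move=> Aa ay rF; have [sF _] := rF; split.
  apply: smooth_near_sum => i; apply: smooth_nearM.
    apply: (@smooth_near_rsubmx _ _ _ _ (fun w => w ord0 i)).
    exact: smooth_near_coord.
  apply: (@smooth_near_lsubmx _ _ _ _ ('D_(delta_mx ord0 i) F)).
  by rewrite row_mxKl; exact: smooth_near_derive.
apply: near_inS (near_inI (near_in_dom _ _) (near_in_foot (represents_near rF))).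
move=> z [/= az rz]; rewrite row_mxKl row_mxKr.
rewrite (tangent_components sA Aa az (vec_tangent z) rz) derive_sum_delta //.
by have [/smooth_near_differentiable] := rz.
Qed.

Lemma tbundle_smooth_atlas : smooth_atlas TA.
Proof.
split=> [y|].
  have [a Aa ay] := atlas_cover sA (foot y).
  by exists (tchart a) => //; exact: tbundle_atlasE.
move=> _ _ y [a Aa ->] [b Ab ->] /= ay by_.
have [_ ch] := sA; have [nb rb] := ch a b _ Aa Ab ay by_.
split; first exact: near_in_foot nb.
move=> i; case: (split_ordP i) => j ->.
  have [F rF] := rb j; exists (F \o lsubmx).
  apply: (represents_eq _ (represents_foot rF)).
  by apply: near_inW => x /=; rewrite row_mxEl.
have [F rF] := rb j; eexists.
apply: (represents_eq _ (represents_vec Aa ay rF)).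
by apply: near_inW => x /=; rewrite row_mxEr mxE.
Qed.

Lemma smooth_at_foot y f : smooth_at A (foot y) f ->
  smooth_at TA y (f \o @foot _ _ _ A).
Proof.
move=> [a [F [Aa ay rF]]]; exists (tchart a), (F \o lsubmx); split => //.
  exact: tbundle_atlasE.
exact: represents_foot.
Qed.

Lemma smooth_at_vec y f : smooth_at A (foot y) f ->
  smooth_at TA y (fun z => vec z f).
Proof.
move=> [a [F [Aa ay rF]]]; exists (tchart a); eexists; split.
- exact: tbundle_atlasE.
- by [].
- exact: (represents_vec Aa ay rF).
Qed.

(** The functions in the two hypotheses are the coordinates of TM in the chart
    that [a] induces. *)
Lemma tbundle_tangent_eq a y (v w : functional R TM) : A a -> dom a (foot y) ->
  tangent TA y v -> tangent TA y w ->
  (forall i, let f q := coord a q ord0 i in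
    v (f \o @foot _ _ _ A) = w (f \o @foot _ _ _ A)) ->
  (forall i, let f q := coord a q ord0 i in
    v (fun z => vec z f) = w (fun z => vec z f)) ->
  v = w.
Proof.
move=> Aa ay tv tw vw1 vw2.
apply: (tangent_eq tbundle_smooth_atlas (tbundle_atlasE Aa) ay tv tw) => i.
case: (split_ordP i) => j ->.
  rewrite (_ : (fun q => _) = (fun q => coord a q ord0 j) \o @foot _ _ _ A).
    exact: vw1.
  by apply/funext => z /=; rewrite row_mxEl.
rewrite (_ : (fun q => _) = (fun z => vec z (fun q => coord a q ord0 j))).
  exact: vw2.
by apply/funext => z /=; rewrite row_mxEr mxE.
Qed.

End TangentBundleAtlas.

(** * Vertical and complete lifts as derivations *)

Section Line.
Context {R : realType}.

Definition line_chart : chart R 1 R := Chart setT (fun t : R => \row_(i < 1) t).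

Lemma near_in_line (t : R) (P : R -> Prop) :
  near_in line_chart t P -> \forall s \near t, P s.
Proof.
move=> nP.
have ct : (\row_(i < 1) s : 'rV[R]_1) @[s --> t] --> (\row_(i < 1) t : 'rV[R]_1).
  by apply: cvg_rV => i; rewrite mxE; under eq_fun do rewrite mxE.
have {}nP := ct _ nP; near=> s.
have /(_ s) : forall q, dom line_chart q -> coord line_chart q = \row_(i < 1) s -> P q.
  by near: s.
by apply.
Unshelve. all: by end_near. Qed.

Lemma is_derive_row_mx n (F : 'rV[R]_(1 + n) -> R) (z : 'rV[R]_n) (t : R) :
  differentiable F (row_mx (\row_(i < 1) t) z) ->
  is_derive t (1 : R) (fun s => F (row_mx (\row_(i < 1) s) z))
    ('D_(row_mx (\row_(i < 1) 1) 0) F (row_mx (\row_(i < 1) t) z)).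
Proof.
have E s : row_mx (\row_(i < 1) s) z
    = row_mx 0 z + s *: row_mx (\row_(i < 1) 1) 0 :> 'rV[R]_(1 + n).
  rewrite scale_row_mx add_row_mx scaler0 addr0 add0r; congr row_mx.
  by apply/rowP => i; rewrite !mxE mulr1.
move=> dF; rewrite (_ : (fun s => _) =
  (fun s => F (row_mx 0 z + s *: row_mx (\row_(i < 1) 1) 0))); last first.
  by apply/funext => s; rewrite E.
apply: is_derive_line; rewrite -E; split => //; exact: diff_derivable.
Qed.

End Line.

Section Lifts.
Context {R : realType} {m : nat} {M : Type} (A : set (chart R m M)).
Context (sA : smooth_atlas A).
Local Notation TM := (tbundle A).
Local Notation TA := (tbundle_atlas A).
Implicit Types (X : vfield R M) (y z : TM) (f : M -> R) (C V : vfield R TM).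

Lemma is_derive_unique (h k : R -> R) (t a b : R) :
  (\forall s \near t, h s = k s) ->
  is_derive t (1 : R) h a -> is_derive t (1 : R) k b -> a = b.
Proof.
move=> hk ha [_ <-].
by have [_ ->] : is_derive t (1 : R) k a by exact: near_eq_is_derive hk ha.
Qed.

Lemma local_flow0 X (p : M) (phi : R -> M -> M) : local_flow A X p phi -> phi 0 p = p.
Proof. by move=> [_ H _]; exact: near_pt_self H. Qed.

Lemma tangent_map_id (p : M) (h : M -> M) v : tangent A p v ->
  near_pt A p (fun q => h q = q) -> tangent_map A h p v = v.
Proof.
move=> tv nh; have hp := near_pt_self nh.
apply/funext => f; rewrite /tangent_map; case: asboolP => sf; last first.
  by rewrite (tangent_nonsmooth tv) // => sf'; apply: sf; rewrite hp.
by apply: (tangent_local sA tv); apply: near_ptS nh => q /= ->.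
Qed.

Lemma vertical_lift_velocity X V y (f : TM -> R) : vertical_lift A X V ->
  smooth_at TA y f -> exists2 gam : R -> TM,
    forall t, foot (gam t) = foot y /\ vec (gam t) = vec y + t *: X (foot y) &
    is_derive (0 : R) (1 : R) (f \o gam) (V y f).
Proof.
move=> [_ /(_ y) [gam gamE vel]] sf; exists gam => //; apply: vel.
suff -> : gam 0 = y by [].
by have [E1 E2] := gamE 0; apply: tbundle_eq => //; rewrite E2 scale0r addr0.
Qed.

Lemma vertical_lift_foot X V y f : vertical_lift A X V ->
  smooth_at A (foot y) f -> V y (f \o @foot _ _ _ A) = 0.
Proof.
move=> HV sf; have [gam gamE vel] := vertical_lift_velocity HV (smooth_at_foot sf).
apply: (is_derive_unique _ vel (is_derive_cst (f (foot y)) _ _)).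
by near=> t; rewrite /= (gamE t).1.
Unshelve. all: by end_near. Qed.

Lemma vertical_lift_vec X V y f : vertical_lift A X V ->
  smooth_at A (foot y) f -> V y (fun z => vec z f) = X (foot y) f.
Proof.
move=> HV sf; have [gam gamE vel] := vertical_lift_velocity HV (smooth_at_vec sA sf).
have d : is_derive (0 : R) (1 : R) (fun t : R => vec y f + t * X (foot y) f)
    (X (foot y) f).
  apply: (@is_derive_eq _ _ _ (cst (vec y f) + id * cst (X (foot y) f))).
  by rewrite scaler0 !add0r /cst /GRing.scale /= mulr1.
apply: (is_derive_unique _ vel d); near=> t.
by rewrite /= (gamE t).2.
Unshelve. all: by end_near. Qed.

Lemma complete_lift_velocity X C y (f : TM -> R) : complete_lift A X C ->
  smooth_at TA y f -> exists phi, local_flow A X (foot y) phi /\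
  exists2 gam : R -> TM,
    \forall t \near (0 : R), foot (gam t) = phi t (foot y) /\
      vec (gam t) = tangent_map A (phi t) (foot y) (vec y) &
    is_derive (0 : R) (1 : R) (f \o gam) (C y f).
Proof.
move=> [_ /(_ y) [phi [flow [gam gamE vel]]]] sf; exists phi; split => //.
exists gam => //; apply: vel; suff -> : gam 0 = y by [].
have [E1 E2] := nbhs_singleton gamE; have [_ id0 _] := flow.
apply: tbundle_eq; first by rewrite E1 (local_flow0 flow).
by rewrite E2 (tangent_map_id (vec_tangent y) id0).
Qed.

(** The integral curves of a complete lift project to those of X. *)
Lemma complete_lift_foot X C y f : complete_lift A X C ->
  smooth_at A (foot y) f -> C y (f \o @foot _ _ _ A) = X (foot y) f.
Proof.
move=> HC sf; have [phi [flow [gam gamE vel]]] :=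
  complete_lift_velocity HC (smooth_at_foot sf).
have [_ _ nd] := flow; have := near_pt_self nd f.
rewrite /= (local_flow0 flow) => /(_ sf) d.
apply: (is_derive_unique _ vel d); near=> t; rewrite /=.
by congr (f _); suff [] : foot (gam t) = phi t (foot y) /\
  vec (gam t) = tangent_map A (phi t) (foot y) (vec y) by []; near: t.
Unshelve. all: by end_near. Qed.

(** Along the flow [phi] of X, the derivative of [vec y (f \o phi t)] in [t] and
    the derivation [vec y] act on the two factors of R * M and commute by the
    symmetry of second derivatives; the first turns [f \o phi t] into [X f]. *)
Lemma complete_lift_vec X C y f : complete_lift A X C ->
  smooth_at A (foot y) f -> C y (fun z => vec z f) = vec y (fun q => X q f).
Proof.
move=> HC sf; have [phi [flow [gam gamE vel]]] :=
  complete_lift_velocity HC (smooth_at_vec sA sf).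
set p := foot y in sf flow gamE *.
have phi0 := local_flow0 flow; have [sphi idphi dphi] := flow.
have sLA := prod_smooth_atlas (@line_smooth_atlas R) sA.
have sf0 : smooth_at A (phi 0 p) f by rewrite phi0.
have [_ [F [[l [b [-> Ab ->]]] [_ /= bp] [sF nF]]]] := sphi f sf0.
have cLA : prod_atlas (line_atlas (R:=R)) A (prod_chart line_chart b).
  by exists line_chart, b.
have dLA : dom (prod_chart line_chart b) (0, p) by [].
pose x0 : 'rV[R]_(1 + m) := row_mx (\row_(i < 1) 0) (coord b p).
pose e : 'rV[R]_(1 + m) := row_mx (\row_(i < 1) 1) 0.
pose xi : 'rV[R]_(1 + m) := row_mx 0 (components b (vec y)).
have sFx : smooth_near x0 F by [].
(* vec (gam t) f, read in the chart *)
have vecE : \forall t \near (0 : R), vec (gam t) f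
    = 'D_xi F (row_mx (\row_(i < 1) t) (coord b p)).
  have n1 : \forall t \near (0 : R), smooth_at A (phi t p) f.
    have nP := near_pt_in sLA cLA dLA (smooth_map_near sA sphi (smooth_at_near sf0)).
    apply: (near_in_line (P := fun t => smooth_at A (phi t p) f)).
    apply: (near_inS _ (near_in_prod (P := fun t q => smooth_at A (phi t q) f) nP)) => t.
    exact: (near_in_self bp).
  have n2 : \forall t \near (0 : R), near_in b p
      (fun q => f (phi t q) = F (row_mx (\row_(i < 1) t) (coord b q))).
    exact: (near_in_line (P := fun t => near_in b p
      (fun q => f (phi t q) = F (row_mx (\row_(i < 1) t) (coord b q))))
      (@near_in_prod _ _ _ _ _ line_chart b 0 p
      (fun t q => f (phi t q) = F (row_mx (\row_(i < 1) t) (coord b q))) nF)).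
  have n3 : \forall t \near (0 : R),
      smooth_near (row_mx (\row_(i < 1) t) (coord b p)) F.
    apply: (near_in_line (P := fun t => smooth_near (row_mx (\row_(i < 1) t) (coord b p)) F)).
    have nS := near_row_mx (near_smooth_near sFx).
    apply: (@near_in_impl _ _ _ line_chart 0 _ _ nS).
    by move=> t _ /nbhs_singleton.
  near=> t.
  have [_ ->] : foot (gam t) = phi t p /\
      vec (gam t) = tangent_map A (phi t) p (vec y) by near: t.
  rewrite tangent_mapE; last by near: t.
  have rt : represents b p (f \o phi t) (fun w => F (row_mx (\row_(i < 1) t) w)).
    by split; [apply: smooth_near_slicer; near: t|near: t].
  by rewrite (tangent_components sA Ab bp (vec_tangent y) rt) derive_slicer.
have dvec := is_derive_row_mx (smooth_near_differentiable (smooth_near_derive xi sFx)).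
rewrite (is_derive_unique vecE vel dvec) (smooth_near_schwarz xi e sFx).
rewrite -derive_slicer.
suff rX : represents b p (fun q => X q f)
    (fun w => 'D_e F (row_mx (\row_(i < 1) 0) w)).
  by rewrite (tangent_components sA Ab bp (vec_tangent y) rX).
split; first exact: (smooth_near_slicer (smooth_near_derive e sFx)).
(* all near conditions at (0, p) hold near (0, q) for q near p *)
pose P (x : R * M) := f (phi x.1 x.2) = F (row_mx (\row_(i < 1) x.1) (coord b x.2)).
have nP : near_in b p (fun q => near_in (prod_chart line_chart b) (0, q) P).
  have n0 : near_in (prod_chart line_chart b) (0, p) P by exact: nF.
  have n1 := near_in_near n0.
  exact: (near_in_self (c := line_chart) I (@near_in_prod _ _ _ _ _ line_chart b 0 p
    (fun t q => near_in (prod_chart line_chart b) (t, q) P) n1)).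
have nD : near_in b p (fun q => forall f, smooth_at A (phi 0 q) f ->
    is_derive (0 : R) (1 : R) (fun s => f (phi s q)) (X (phi 0 q) f)).
  have n1 := near_pt_in sLA cLA dLA dphi.
  exact: (near_in_self (c := line_chart) I (@near_in_prod _ _ _ _ _ line_chart b 0 p
    (fun t q => forall f, smooth_at A (phi t q) f ->
    is_derive t (1 : R) (fun s => f (phi s q)) (X (phi t q) f)) n1)).
have nI := near_pt_in sA Ab bp idphi.
have nS := near_pt_in sA Ab bp (smooth_at_near sf).
have nF' : near_in b p (fun q => smooth_near (row_mx (\row_(i < 1) 0) (coord b q)) F).
  apply: (near_in_coord (O := fun w => smooth_near (row_mx (\row_(i < 1) 0) w) F)).
  exact: (nbhs_singleton (near_row_mx (near_smooth_near sFx))).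
apply: near_inS (near_inI (near_in_dom b p) (near_inI nP (near_inI nD
  (near_inI nI (near_inI nS nF'))))) => q [bq [Pq [Dq [Iq [Sq Fq]]]]].
have dq : is_derive (0 : R) (1 : R) (fun s => f (phi s q)) (X q f).
  by have := Dq f; rewrite Iq; apply.
apply: (is_derive_unique _ dq (is_derive_row_mx (smooth_near_differentiable Fq))).
apply: (near_in_line (P := fun t => f (phi t q) = F (row_mx (\row_(i < 1) t) (coord b q)))).
apply: near_inS (near_in_prod (P := fun t q => f (phi t q) =
  F (row_mx (\row_(i < 1) t) (coord b q))) Pq) => t.
exact: near_in_self.
Unshelve. all: by end_near. Qed.

End Lifts.

(** * Brackets of vector fields and of lifts *)

Section Bracket.
Context {R : realType} {m : nat} {M : Type} (A : set (chart R m M)).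
Context (sA : smooth_atlas A).
Implicit Types (X Y Z : vfield R M) (p : M) (f : M -> R).
Local Notation br := (bracket A).

Lemma bracketE X Y p f : smooth_at A p f ->
  br X Y p f = X p (fun q => Y q f) - Y p (fun q => X q f).
Proof. by move=> sf; rewrite /bracket; case: asboolP. Qed.

Lemma bracketC X Y : br Y X = - br X Y.
Proof.
apply/funext => p; apply/funext => f; rewrite !fctE /bracket.
by case: asboolP => _; rewrite ?opprB ?oppr0.
Qed.

Lemma bracketxx X : br X X = 0.
Proof.
by apply/funext => p; apply/funext => f; rewrite /bracket subrr; case: asboolP.
Qed.

Lemma bracket_combl (a : R) X Y Z :
  vector_field A X -> vector_field A Y -> vector_field A Z ->
  br (a *: X + Y) Z = a *: br X Z + br Y Z.
Proof.
move=> [_ sX] [_ sY] [tZ sZ]; apply/funext => p; apply/funext => f.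
rewrite !fctE /bracket; case: asboolP => sf; last by rewrite scaler0 addr0.
rewrite (_ : (fun q => (a *: X + Y) q f) = (fun q => a * X q f + Y q f)) //.
rewrite (tangent_fcomb sA a (tZ p) (sX p f sf) (sY p f sf)) /GRing.scale /=.
rewrite !fctE /=.
by rewrite -![_ *: _]/(_ * _) mulrBr opprD addrACA.
Qed.

Lemma bracket_combr (a : R) X Y Z :
  vector_field A X -> vector_field A Y -> vector_field A Z ->
  br Z (a *: X + Y) = a *: br Z X + br Z Y.
Proof.
move=> vX vY vZ; rewrite (bracketC (a *: X + Y) Z) bracket_combl //.
by rewrite (bracketC Z X) (bracketC Z Y) scalerN opprD !opprK.
Qed.

(** Both sides expand, on a function smooth at p, into the same third-order
    expressions; the expansion holds only near p, which suffices as vectors see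
    germs. *)
Lemma bracket_jacobi X Y Z :
  vector_field A X -> vector_field A Y -> vector_field A Z ->
  br (br X Y) Z = br X (br Y Z) - br Y (br X Z).
Proof.
move=> [tX sX] [tY sY] [tZ sZ]; apply/funext => p; apply/funext => f.
rewrite !fctE /=; case: (pselect (smooth_at A p f)) => sf; last first.
  by rewrite /bracket; case: asboolP; rewrite ?subr0.
have E U V W : vector_field A U -> vector_field A V -> vector_field A W ->
    U p (fun q => br V W q f) = U p (fun q => V q (fun q => W q f))
                              - U p (fun q => W q (fun q => V q f)).
  move=> [tU sU] [tV sV] [tW sW].
  rewrite (tangent_local sA (g := fun q => -1 * W q (fun q => V q f)
      + V q (fun q => W q f)) (tU p)); last first.
    by apply: near_ptS (smooth_at_near sf) => q sq; rewrite bracketE // mulN1r addrC.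
  rewrite (tangent_fcomb sA _ (tU p)) ?mulN1r 1?addrC //.
    by apply: sW; apply: sV.
  by apply: sV; apply: sW.
rewrite !(bracketE _ _ sf) !E //; try by split.
by rewrite !bracketE; [ring|exact: sY|exact: sX|exact: sZ].
Qed.

End Bracket.

Section LiftBracket.
Context {R : realType} {m : nat} {M : Type} (A : set (chart R m M)).
Context (sA : smooth_atlas A).
Local Notation TM := (tbundle A).
Local Notation TA := (tbundle_atlas A).
Implicit Types (X Y Z : vfield R M) (C D V W : vfield R TM) (f : M -> R).

Let sTA := tbundle_smooth_atlas sA.

Lemma near_foot y f : smooth_at A (foot y) f ->
  near_pt TA y (fun z : TM => smooth_at A (foot z) f).
Proof. by move=> sf; exact: near_pt_foot (smooth_at_near sf). Qed.

(** The three bracket relations are read off on the coordinates of TM, of the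
    form [f \o foot] and [vec ^~ f], where lifts act through X and Y: a complete
    lift sends them to [X f \o foot] and [vec ^~ (X f)], a vertical one to 0 and
    to [X f \o foot]. *)
Lemma complete_lift_bracket X Y C D E :
  vector_field A X -> vector_field A Y -> vector_field TA (bracket TA C D) ->
  complete_lift A X C -> complete_lift A Y D -> complete_lift A (bracket A X Y) E ->
  bracket TA C D = E.
Proof.
move=> [tX sX] [tY sY] [tB _] HC HD HE; apply/funext => y.
have [[tC _] _] := HC; have [[tD _] _] := HD; have [[tE _] _] := HE.
have [a Aa ay] := atlas_cover sA (foot y).
apply: (tbundle_tangent_eq sA Aa ay (tB y) (tE y)) => i f.
  have sf : smooth_at A (foot y) f := smooth_at_coord i Aa ay.
  rewrite bracketE; last exact: smooth_at_foot.
  rewrite (complete_lift_foot sA HE sf) bracketE //; congr (_ - _).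
    rewrite -(complete_lift_foot sA HC (sY _ _ sf)).
    apply: (tangent_local sTA (tC y)); apply: near_ptS (near_foot sf) => z sz.
    exact: (complete_lift_foot sA HD sz).
  rewrite -(complete_lift_foot sA HD (sX _ _ sf)).
  apply: (tangent_local sTA (tD y)); apply: near_ptS (near_foot sf) => z sz.
  exact: (complete_lift_foot sA HC sz).
have sf : smooth_at A (foot y) f := smooth_at_coord i Aa ay.
rewrite bracketE; last exact: smooth_at_vec.
rewrite (complete_lift_vec sA HE sf).
rewrite (tangent_local sA (g := fun q => -1 * Y q (fun q => X q f)
      + X q (fun q => Y q f)) (vec_tangent y)); last first.
  by apply: near_ptS (smooth_at_near sf) => q sq; rewrite bracketE // mulN1r addrC.
rewrite (tangent_fcomb sA _ (vec_tangent y)) ?mulN1r; last 2 first.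
- by apply: sY; apply: sX.
- by apply: sX; apply: sY.
rewrite addrC; congr (- _ + _).
  rewrite -(complete_lift_vec sA HD (sX _ _ sf)).
  apply: (tangent_local sTA (tD y)); apply: near_ptS (near_foot sf) => z sz.
  exact: (complete_lift_vec sA HC sz).
rewrite -(complete_lift_vec sA HC (sY _ _ sf)).
apply: (tangent_local sTA (tC y)); apply: near_ptS (near_foot sf) => z sz.
exact: (complete_lift_vec sA HD sz).
Qed.

Lemma mixed_lift_bracket X Y C V W :
  vector_field A X -> vector_field A Y -> vector_field TA (bracket TA C V) ->
  complete_lift A X C -> vertical_lift A Y V -> vertical_lift A (bracket A X Y) W ->
  bracket TA C V = W.
Proof.
move=> [tX sX] [tY sY] [tB _] HC HV HW; apply/funext => y.
have [[tC _] _] := HC; have [[tV _] _] := HV; have [[tW _] _] := HW.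
have [a Aa ay] := atlas_cover sA (foot y).
apply: (tbundle_tangent_eq sA Aa ay (tB y) (tW y)) => i f.
  have sf : smooth_at A (foot y) f := smooth_at_coord i Aa ay.
  rewrite bracketE; last exact: smooth_at_foot.
  rewrite (vertical_lift_foot HW sf).
  rewrite (tangent_local sTA (g := cst 0) (tC y)); last first.
    apply: near_ptS (near_foot sf) => z sz; exact: (vertical_lift_foot HV sz).
  rewrite (tangent_cst sTA 0 (tC y)) sub0r.
  rewrite (tangent_local sTA (g := (fun q => X q f) \o @foot _ _ _ A) (tV y)).
    by rewrite (vertical_lift_foot HV (sX _ _ sf)) oppr0.
  by apply: near_ptS (near_foot sf) => z sz; exact: (complete_lift_foot sA HC sz).
have sf : smooth_at A (foot y) f := smooth_at_coord i Aa ay.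
rewrite bracketE; last exact: smooth_at_vec.
rewrite (vertical_lift_vec sA HW sf) bracketE //; congr (_ - _).
  rewrite -(complete_lift_foot sA HC (sY _ _ sf)).
  apply: (tangent_local sTA (tC y)); apply: near_ptS (near_foot sf) => z sz.
  exact: (vertical_lift_vec sA HV sz).
rewrite -(vertical_lift_vec sA HV (sX _ _ sf)).
apply: (tangent_local sTA (tV y)); apply: near_ptS (near_foot sf) => z sz.
exact: (complete_lift_vec sA HC sz).
Qed.

Lemma vertical_lift_bracket X Y V W :
  vector_field A X -> vector_field A Y -> vector_field TA (bracket TA V W) ->
  vertical_lift A X V -> vertical_lift A Y W -> bracket TA V W = 0.
Proof.
move=> [tX sX] [tY sY] [tB _] HV HW; apply/funext => y.
have [[tV _] _] := HV; have [[tW _] _] := HW.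
have [a Aa ay] := atlas_cover sA (foot y).
have t0 : tangent TA y (0 : functional R TM).
  by rewrite -(subrr (V y)) addrC -scaleN1r; exact: (tangent_comb sTA).
apply: (tbundle_tangent_eq sA Aa ay (tB y) t0) => i f.
  have sf : smooth_at A (foot y) f := smooth_at_coord i Aa ay.
  rewrite bracketE; last exact: smooth_at_foot.
  have vert U U' X' : vertical_lift A X' U -> tangent TA y (U' y) ->
      U' y (fun z => U z (f \o @foot _ _ _ A)) = 0.
    move=> HU tU; rewrite (tangent_local sTA (g := cst 0) tU).
      exact: (tangent_cst sTA 0 tU).
    by apply: near_ptS (near_foot sf) => z sz; exact: (vertical_lift_foot HU sz).
  by rewrite (vert W V _ HW (tV y)) (vert V W _ HV (tW y)) subr0.
have sf : smooth_at A (foot y) f := smooth_at_coord i Aa ay.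
rewrite bracketE; last exact: smooth_at_vec.
have vert U U' X' Y' : vertical_lift A X' U -> vertical_lift A Y' U' ->
    vector_field A X' -> U' y (fun z => U z (fun z => vec z f)) = 0.
  move=> HU HU' [_ sX']; have [[tU' _] _] := HU'.
  rewrite (tangent_local sTA (g := (fun q => X' q f) \o @foot _ _ _ A) (tU' y)).
    exact: (vertical_lift_foot HU' (sX' _ _ sf)).
  by apply: near_ptS (near_foot sf) => z sz; exact: (vertical_lift_vec sA HU sz).
rewrite (vert W V Y X HW HV) ?(vert V W X Y HV HW) ?subr0 //.
Qed.

End LiftBracket.

(** * Left-invariant fields on a Lie group *)

Section LeftInvariant.
Context {R : realType} {n : nat} (G : lieGroupType R n).
Local Notation A := (atlas : set (chart R n G)).
Local Notation L x := (fun z : G => (x * z)%g).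
Implicit Types (X Y Z : vfield R G) (p q x y : G) (f : G -> R).

Lemma lie_smooth_atlas : smooth_atlas A.
Proof. exact: manifold_smooth_atlas atlas_manifold. Qed.

Let sA := lie_smooth_atlas.

(** One function F represents [f] composed with left translation by z, for all z
    near x at once, because the product is jointly smooth. *)
Lemma mulg_represents x y f : smooth_at A (x * y)%g f ->
  exists a b F, [/\ A a, A b, dom a x, dom b y &
    smooth_near (row_mx (coord a x) (coord b y)) F /\
    near_in a x (fun z => represents b y (f \o L z) (fun w => F (row_mx (coord a z) w)))].
Proof.
move=> sf; have [_ [F [[a [b [Aa Ab ->]]] [/= ax by_] [sF nF]]]] :=
  smooth_mulg (x, y) f sf.
exists a, b, F; split => //; split => //.
have n1 := near_in_prod (P := fun z w => f (z * w)%g = F (row_mx (coord a z) (coord b w))) nF.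
have n2 := near_row_mx (near_smooth_near sF).
apply: near_inS (near_inI n1 (near_in_coord n2)) => z [nz /nbhs_singleton sz].
by split => //; apply: smooth_near_slicer.
Qed.

Lemma smooth_left_mul x p : smooth_map_at A A (L x) p.
Proof.
move=> f /mulg_represents [a [b [F [Aa Ab ax bp [_ /(near_in_self ax) rF]]]]].
by exists b; eexists; split; last exact: rF.
Qed.

Lemma smooth_at_left_mul x p f : smooth_at A (x * p)%g f <-> smooth_at A p (f \o L x).
Proof.
split; first exact: smooth_left_mul.
move=> sf; have := @smooth_left_mul x^-1%g (x * p)%g (f \o L x).
rewrite mulgA mulVg mul1g => /(_ sf).
by rewrite (_ : _ \o _ = f) //; apply/funext => q /=; rewrite mulgA mulgV mul1g.
Qed.

Lemma near_left_mul x p (P : G -> Prop) :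
  near_pt A (x * p)%g P -> near_pt A p (P \o L x).
Proof. by move=> nP; exact: (smooth_map_near sA (@smooth_left_mul x p) nP). Qed.

(** Left translates of a vector at 1 form a smooth field, because the product
    is smooth in both variables jointly. *)
Lemma left_translates_lie (v : functional R G) : tangent A 1%g v ->
  lie_algebra G (fun p => tangent_map A (L p) 1%g v).
Proof.
move=> tv; split; last first.
  move=> x y; apply/funext => f; rewrite /tangent_map.
  case: asboolP => sf; case: asboolP => sf' //=.
  - case: asboolP => sf2; last first.
      by exfalso; apply: sf2; rewrite mulg1; exact/smooth_at_left_mul; rewrite -?mulgA in sf.
    congr (v _); apply/funext => z /=; by rewrite mulgA.
  - by case: sf'; move: sf; rewrite mulg1.
  - by case: sf; rewrite mulg1.
split=> [p|p f sf].
  by have := tangent_map_tangent sA sA (@smooth_left_mul p 1%g) tv; rewrite mulg1.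
have sf1 : smooth_at A (p * 1)%g f by rewrite mulg1.
have [a [b [F [Aa Ab ap b1 [sF nF]]]]] := mulg_represents sf1.
pose xi : 'rV[R]_(n + n) := row_mx 0 (components b v).
exists a, (fun w => 'D_xi F (row_mx w (coord b 1%g))); split => //; split.
  exact: (smooth_near_slicel (smooth_near_derive xi sF)).
have nS := near_pt_in sA Aa ap (smooth_at_near sf).
apply: near_inS (near_inI nF nS) => q [rq sq].
rewrite tangent_mapE ?mulg1 // (tangent_components sA Ab b1 tv rq).
exact: derive_slicer.
Qed.

Lemma lie_algebra_at X p : lie_algebra G X -> X p = tangent_map A (L p) 1%g (X 1%g).
Proof. by move=> [_ /(_ p 1%g)]; rewrite mulg1. Qed.

(** The vector is translated to 1 and spread from there by left translations. *)
Lemma lie_algebra_span p v : tangent A p v -> exists2 D, lie_algebra G D & D p = v.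
Proof.
move=> tv; have := tangent_map_tangent sA sA (@smooth_left_mul p^-1%g p) tv.
rewrite mulVg => t1; eexists; first exact: left_translates_lie t1.
apply/funext => f; rewrite /tangent_map mulg1; case: asboolP => sf.
  case: asboolP => [_|[]].
    by congr (v _); apply/funext => z /=; rewrite mulgA mulgV mul1g.
  by rewrite mulVg; apply: smooth_left_mul; rewrite mulg1.
by rewrite (tangent_nonsmooth tv sf).
Qed.

Lemma lie_algebra_comb (a : R) X Y : lie_algebra G X -> lie_algebra G Y ->
  lie_algebra G (a *: X + Y).
Proof.
move=> [vX lX] [vY lY]; split; first exact: (vector_field_comb sA).
move=> x y; apply/funext => f; rewrite !fctE lX lY /tangent_map.
by case: asboolP => // _; rewrite scaler0 addr0.
Qed.

(** Left translations carry X and Y to themselves, as derivations of germs, hence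
    also the commutator of X and Y. *)
Lemma lie_algebra_bracket X Y : lie_algebra G X -> lie_algebra G Y ->
  vector_field A (bracket A X Y) -> lie_algebra G (bracket A X Y).
Proof.
move=> [[tX sX] lX] [[tY sY] lY] vB; split => // x y; apply/funext => f.
case: (pselect (smooth_at A (x * y)%g f)) => sf; last first.
  by rewrite /bracket /tangent_map; case: asboolP => // _; case: asboolP.
have sfL : smooth_at A y (f \o L x) by exact: smooth_left_mul.
rewrite tangent_mapE // !bracketE //.
have E U V : vector_field A U -> vector_field A V ->
    (forall x y, U (x * y)%g = tangent_map A (L x) y (U y)) ->
    (forall x y, V (x * y)%g = tangent_map A (L x) y (V y)) ->
    U (x * y)%g (fun q => V q f) = U y (fun q => V q (f \o L x)).
  move=> [tU sU] [tV sV] lU lV; rewrite lU tangent_mapE; last exact: (sV _ _ sf).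
  apply: (tangent_local sA (tU y)).
  apply: near_ptS (near_left_mul (smooth_at_near sf)) => q sq /=.
  by rewrite lV tangent_mapE.
by rewrite (E X Y (conj tX sX) (conj tY sY) lX lY) (E Y X (conj tY sY) (conj tX sX) lY lX).
Qed.

End LeftInvariant.

Section InvariantMetric.
Context {R : realType} {n : nat} (G : lieGroupType R n).
Local Notation A := (atlas : set (chart R n G)).
Context (g : tensor2 R G) (rg : riemannian A g)
  (lg : left_invariant_metric A (fun x y : G => (x * y)%g) g).
Implicit Types (X Y Z : vfield R G) (p : G).
Local Notation ip := (inner g).

Lemma lie_tangent X p : lie_algebra G X -> tangent A p (X p).
Proof. by move=> [[tX _] _]. Qed.

Lemma inner_at X Y p : lie_algebra G X -> lie_algebra G Y -> g p (X p) (Y p) = ip X Y.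
Proof.
move=> lX lY; rewrite (lie_algebra_at p lX) (lie_algebra_at p lY).
have := lg p (lie_tangent 1%g lX) (lie_tangent 1%g lY).
by rewrite mulg1.
Qed.

Lemma innerC X Y : lie_algebra G X -> lie_algebra G Y -> ip X Y = ip Y X.
Proof. by have [_ sg _ _] := rg; move=> lX lY; apply: sg; exact: lie_tangent. Qed.

Lemma inner_combl (a : R) X Y Z :
  lie_algebra G X -> lie_algebra G Y -> lie_algebra G Z ->
  ip (a *: X + Y) Z = a * ip X Z + ip Y Z.
Proof. by have [bg _ _ _] := rg; move=> lX lY lZ; apply: bg; exact: lie_tangent. Qed.

Lemma inner_combr (a : R) X Y Z :
  lie_algebra G X -> lie_algebra G Y -> lie_algebra G Z ->
  ip Z (a *: X + Y) = a * ip Z X + ip Z Y.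
Proof.
move=> lX lY lZ; rewrite innerC ?inner_combl // ?(innerC lZ) //.
exact: lie_algebra_comb.
Qed.

Lemma inner_gt0 X : lie_algebra G X -> X <> 0 -> 0 < ip X X.
Proof.
have [_ _ pg _] := rg; move=> lX X0; apply: pg; first exact: lie_tangent.
move=> X1; apply: X0; apply/funext => p; rewrite (lie_algebra_at p lX) X1.
by apply/funext => f; rewrite /tangent_map; case: asboolP.
Qed.

End InvariantMetric.

(** * Levi-Civita connections and fields of constant inner products *)

Section LeviCivita.
Context {R : realType} {m : nat} {M : Type} (A : set (chart R m M)).
Context (sA : smooth_atlas A) (g : tensor2 R M)
  (nabla : vfield R M -> vfield R M -> vfield R M).
Context (rg : riemannian A g) (lc : levi_civita A g nabla).
Implicit Types (X Y Z : vfield R M) (p : M) (u v w : functional R M).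
Local Notation vf := (vector_field A).
Local Notation br := (bracket A).

Lemma metricC p u v : tangent A p u -> tangent A p v -> g p u v = g p v u.
Proof. by have [_ + _ _] := rg; exact. Qed.

Lemma metricB p u v w : tangent A p u -> tangent A p v -> tangent A p w ->
  g p (u - v) w = g p u w - g p v w.
Proof.
move=> tu tv tw; have [bg _ _ _] := rg.
by rewrite addrC -scaleN1r bg // mulN1r addrC.
Qed.

Lemma metric_gt0 p v : tangent A p v -> v <> 0 -> 0 < g p v v.
Proof. by have [_ _ + _] := rg; exact. Qed.

Lemma vf_tangent X p : vf X -> tangent A p (X p).
Proof. by move=> [tX _]. Qed.

Lemma tangentB p u v : tangent A p u -> tangent A p v -> tangent A p (u - v).
Proof. by move=> tu tv; rewrite addrC -scaleN1r; exact: tangent_comb. Qed.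

Lemma nabla_vf X Y : vf X -> vf Y -> vf (nabla X Y).
Proof. by have [[+ _ _] _ _] := lc; exact. Qed.

Lemma nabla_torsion X Y : vf X -> vf Y -> nabla X Y - nabla Y X = br X Y.
Proof. by have [_ + _] := lc; exact. Qed.

Lemma bracket_vf X Y : vf X -> vf Y -> vf (br X Y).
Proof.
move=> vX vY; rewrite -nabla_torsion // addrC -scaleN1r.
by apply: vector_field_comb => //; exact: nabla_vf.
Qed.

Lemma nabla0l Y : vf Y -> nabla 0 Y = 0.
Proof.
move=> vY; have [[_ lin _] _ _] := lc.
have := lin (cst (-1)) Y Y Y (fun p => smooth_at_cst sA p (-1)) vY vY vY.
rewrite (_ : (fun p => _) = 0); last first.
  by apply/funext => p; rewrite scaleN1r addNr.
by move=> ->; apply/funext => p; rewrite scaleN1r addNr.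
Qed.

Definition constant_inner X Y := forall p q, g p (X p) (Y p) = g q (X q) (Y q).

(** The derivative of the constant function [g Y Z] along X vanishes. *)
Lemma nabla_metric X Y Z p : vf X -> vf Y -> vf Z -> constant_inner Y Z ->
  g p (nabla X Y p) (Z p) = - g p (Y p) (nabla X Z p).
Proof.
move=> vX vY vZ cYZ; have [_ _ comp] := lc; have := comp X Y Z p vX vY vZ.
rewrite (_ : (fun q => _) = cst (g p (Y p) (Z p))); last first.
  by apply/funext => q; exact: cYZ.
rewrite (tangent_cst sA _ (vf_tangent p vX)) => /esym/eqP.
by rewrite addr_eq0 => /eqP.
Qed.

(** Koszul's formula loses its terms that differentiate inner products when these
    are constant. *)
Lemma koszul X Y Z p : vf X -> vf Y -> vf Z ->
  constant_inner X Y -> constant_inner Y Z -> constant_inner Z X ->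
  2 * g p (nabla X Y p) (Z p) =
    g p (br X Y p) (Z p) - g p (br Y Z p) (X p) + g p (br Z X p) (Y p).
Proof.
move=> vX vY vZ cXY cYZ cZX.
have t V W : vf V -> vf W -> tangent A p (nabla V W p).
  by move=> vV vW; exact/vf_tangent/nabla_vf.
have brE V W Z' : vf V -> vf W -> vf Z' -> g p (br V W p) (Z' p) =
    g p (nabla V W p) (Z' p) - g p (nabla W V p) (Z' p).
  move=> vV vW vZ'; rewrite -nabla_torsion //.
  by apply: metricB; [exact: t|exact: t|exact: vf_tangent].
rewrite !brE //.
have e1 := nabla_metric p vX vY vZ cYZ.
have e2 := nabla_metric p vY vZ vX cZX.
have e3 := nabla_metric p vZ vX vY cXY.
rewrite (metricC (vf_tangent p vY) (t _ _ vX vZ)) in e1.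
rewrite (metricC (vf_tangent p vZ) (t _ _ vY vX)) in e2.
rewrite (metricC (vf_tangent p vX) (t _ _ vZ vY)) in e3.
rewrite e1 e2 e3; ring.
Qed.

(** As the inner products of [nabla Y Y] and of [nabla X Y] with X are constant,
    the outer derivatives in the definition of the curvature can be moved to X
    at the price of a sign. The formula involves only first derivatives, which
    Koszul's formula gives. *)
Lemma curvature_inner X Y p : vf X -> vf Y ->
  constant_inner (nabla Y Y) X -> constant_inner (nabla X Y) X ->
  g p (curvature A nabla X Y Y p) (X p) =
  - g p (nabla Y Y p) (nabla X X p) + g p (nabla X Y p) (nabla Y X p)
  - g p (nabla (br X Y) Y p) (X p).
Proof.
move=> vX vY c1 c2.
have n V W : vf V -> vf W -> vf (nabla V W) by exact: nabla_vf.
have vB := bracket_vf vX vY.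
have t V : vf V -> tangent A p (V p) by exact: vf_tangent.
have t1 := t _ (n _ _ vX (n _ _ vY vY)); have t2 := t _ (n _ _ vY (n _ _ vX vY)).
rewrite /curvature !fctE (metricB (tangentB t1 t2) (t _ (n _ _ vB vY)) (t _ vX)).
rewrite (metricB t1 t2 (t _ vX)).
rewrite (nabla_metric p vX (n _ _ vY vY) vX c1).
by rewrite (nabla_metric p vY (n _ _ vX vY) vX c2) opprK.
Qed.

End LeviCivita.

(** * The Lie algebra with its inner product *)

Section MetricLieAlgebra.
Context {R : realType} {n : nat} (G : lieGroupType R n).
Local Notation A := (atlas : set (chart R n G)).
Context (g : tensor2 R G) (nabla : vfield R G -> vfield R G -> vfield R G).
Context (rg : riemannian A g)
  (lg : left_invariant_metric A (fun x y : G => (x * y)%g) g)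
  (lc : levi_civita A g nabla).
Implicit Types (X Y Z D u : vfield R G) (p : G).
Local Notation ip := (inner g).
Local Notation br := (bracket A).
Local Notation lie := (lie_algebra G).
Local Notation dg := (derived_algebra G).
Local Notation P := (orthogonal_complement g dg).

Let sA : smooth_atlas A := lie_smooth_atlas G.

Lemma lie_vf X : lie X -> vector_field A X. Proof. by case. Qed.

Lemma lie_br X Y : lie X -> lie Y -> lie (br X Y).
Proof.
move=> lX lY; apply: lie_algebra_bracket => //.
by apply: (bracket_vf sA lc); exact: lie_vf.
Qed.

Lemma lie0 : lie 0.
Proof.
split; last by move=> x y; apply/funext => f; rewrite /tangent_map; case: asboolP.
split=> [p|p f sf]; last exact: smooth_at_cst.
have [c Ac cp] := atlas_cover sA p.
apply: (tangent_build Ac cp (xi := 0)) => // f F _.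
by rewrite derive0.
Qed.

Lemma lieZ (a : R) X : lie X -> lie (a *: X).
Proof. by move=> lX; rewrite -[_ *: _]addr0; apply: lie_algebra_comb => //; exact: lie0. Qed.

Lemma lieD X Y : lie X -> lie Y -> lie (X + Y).
Proof. by move=> lX lY; rewrite -[X]scale1r; apply: lie_algebra_comb. Qed.

Lemma ip0l Z : lie Z -> ip 0 Z = 0.
Proof.
move=> lZ; have := inner_combl rg 1 lie0 lie0 lZ.
by rewrite scale1r addr0 mul1r => /eqP; rewrite addrC -subr_eq subrr => /eqP.
Qed.

Lemma ipZl (a : R) X Z : lie X -> lie Z -> ip (a *: X) Z = a * ip X Z.
Proof.
move=> lX lZ; rewrite -[a *: X]addr0 (inner_combl rg) ?ip0l ?addr0 //; exact: lie0.
Qed.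

Lemma ipDl X Y Z : lie X -> lie Y -> lie Z -> ip (X + Y) Z = ip X Z + ip Y Z.
Proof. by move=> lX lY lZ; rewrite -[X]scale1r (inner_combl rg) // mul1r scale1r. Qed.

Lemma ipNl X Z : lie X -> lie Z -> ip (- X) Z = - ip X Z.
Proof. by move=> lX lZ; rewrite -scaleN1r ipZl // mulN1r. Qed.

Lemma ipZr (a : R) X Z : lie X -> lie Z -> ip Z (a *: X) = a * ip Z X.
Proof.
by move=> lX lZ; rewrite (innerC rg) ?ipZl // ?(innerC rg lX) //; exact: lieZ.
Qed.

Lemma lie_eq X Y : lie X -> lie Y -> (forall Z, lie Z -> ip X Z = ip Y Z) -> X = Y.
Proof.
move=> lX lY XY; apply: contrapT => nXY.
have lD : lie (X - Y) by rewrite addrC -scaleN1r; exact: lie_algebra_comb.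
have := inner_gt0 rg lD => H.
have {}H : 0 < ip (X - Y) (X - Y) by apply: H => /eqP; rewrite subr_eq0 => /eqP.
move: H; rewrite ipDl ?ipNl //; last by rewrite -scaleN1r; exact: lieZ.
by rewrite XY // subrr ltxx.
Qed.

Lemma lie_constant_inner X Y : lie X -> lie Y -> constant_inner g X Y.
Proof. by move=> lX lY p q; rewrite !(inner_at lg). Qed.

Lemma koszul_lie_at X Y Z p : lie X -> lie Y -> lie Z ->
  2 * g p (nabla X Y p) (Z p) =
    ip (br X Y) Z - ip (br Y Z) X + ip (br Z X) Y.
Proof.
move=> lX lY lZ; rewrite (koszul sA rg lc); try exact: lie_vf; try exact: lie_constant_inner.
by rewrite !(inner_at lg) //; exact: lie_br.
Qed.

(** By Koszul's formula the inner products of [nabla X Y] with left-invariant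
    fields are constant, and left-invariant fields span each tangent space. *)
Lemma nabla_lie X Y : lie X -> lie Y -> lie (nabla X Y).
Proof.
move=> lX lY; have vN := nabla_vf lc (lie_vf lX) (lie_vf lY).
have [D lD D1] := lie_algebra_span (vf_tangent 1%g vN).
suff -> : nabla X Y = D by [].
apply/funext => p; have [D' lD' Dp] := lie_algebra_span (vf_tangent p vN).
rewrite -Dp; congr (_ p); apply: lie_eq => // Z lZ.
have two : (2 : R) != 0 by rewrite pnatr_eq0.
apply: (mulfI two); rewrite -(inner_at lg p lD' lZ) -(inner_at lg 1%g lD lZ) D1 Dp.
by rewrite !koszul_lie_at.
Qed.

Lemma koszul_lie X Y Z : lie X -> lie Y -> lie Z ->
  2 * ip (nabla X Y) Z = ip (br X Y) Z - ip (br Y Z) X + ip (br Z X) Y.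
Proof. by move=> lX lY lZ; exact: koszul_lie_at. Qed.

Lemma curvature_lie X Y p : lie X -> lie Y ->
  g p (curvature A nabla X Y Y p) (X p) =
  - ip (nabla Y Y) (nabla X X) + ip (nabla X Y) (nabla Y X) - ip (nabla (br X Y) Y) X.
Proof.
move=> lX lY; have lB := lie_br lX lY.
rewrite (curvature_inner sA rg lc); try exact: lie_vf;
  try by apply: lie_constant_inner => //; exact: nabla_lie.
by rewrite !(inner_at lg) //; exact: nabla_lie.
Qed.

(** * The derived algebra *)

Lemma derived_ind (Q : vfield R G -> Prop) : Q 0 ->
  (forall (a : R) X Y, Q X -> Q Y -> Q (a *: X + Y)) ->
  (forall X Y, lie X -> lie Y -> Q (br X Y)) -> forall Z, dg Z -> Q Z.
Proof.
move=> Q0 Qc Qb _ [k [a [X [Y [lXY ->]]]]].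
elim/big_rec: _ => // i Z _ QZ; apply: Qc => //.
by have [lX lY] := lXY i; exact: Qb.
Qed.

Lemma derived_br X Y : lie X -> lie Y -> dg (br X Y).
Proof.
move=> lX lY; exists 1, (fun=> 1), (fun=> X), (fun=> Y); split => //.
by rewrite big_ord1 scale1r.
Qed.

Lemma derived_lie Z : dg Z -> lie Z.
Proof.
apply: derived_ind; [exact: lie0|exact: lie_algebra_comb|exact: lie_br].
Qed.

Lemma derived_comb (a : R) X Y : dg X -> dg Y -> dg (a *: X + Y).
Proof.
move=> [k [b [U [V [lUV ->]]]]] [k' [b' [U' [V' [lUV' ->]]]]].
exists (k + k')%N, (fun i => match fintype.split i with inl j => a * b j | inr j => b' j end),
  (fun i => match fintype.split i with inl j => U j | inr j => U' j end),
  (fun i => match fintype.split i with inl j => V j | inr j => V' j end); split.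
  by move=> i; case: fintype.split => j.
rewrite big_split_ord /= scaler_sumr; congr (_ + _); apply: eq_bigr => i _.
  by rewrite (unsplitK (inl i)) scalerA.
by rewrite (unsplitK (inr i)).
Qed.

Lemma P_lie u : P u -> lie u. Proof. by case. Qed.

Lemma P_br u X Y : P u -> lie X -> lie Y -> ip (br X Y) u = 0.
Proof.
move=> [lu ou] lX lY; rewrite (innerC rg) //; last exact: lie_br.
by apply: ou; exact: derived_br.
Qed.

Lemma nabla_P u : P u -> nabla u u = 0.
Proof.
move=> Pu; have lu := P_lie Pu; apply: lie_eq; [exact: nabla_lie|exact: lie0|].
move=> Z lZ; apply/eqP; rewrite ip0l // -(mulrI_eq0 _ (@mulfI _ 2 _)) ?pnatr_eq0 //.
by rewrite koszul_lie // bracketxx ip0l // !(P_br Pu) // subr0 addr0.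
Qed.

Section OrthonormalBasis.
Context (e0 e1 : vfield R G) (d0 : dg e0) (d1 : dg e1)
  (e00 : ip e0 e0 = 1) (e11 : ip e1 e1 = 1) (e01 : ip e0 e1 = 0)
  (span : forall Z, dg Z -> exists a b : R, Z = a *: e0 + b *: e1).

Let l0 := derived_lie d0.
Let l1 := derived_lie d1.

Lemma derived_expand Z : dg Z -> Z = ip Z e0 *: e0 + ip Z e1 *: e1.
Proof.
move=> /span [a [b ->]]; have lb := lieZ b l1.
have e10 : ip e1 e0 = 0 by rewrite (innerC rg).
rewrite !(inner_combl rg) // !ipZl // e00 e11 e01 e10.
by rewrite !mulr1 !mulr0 add0r addr0.
Qed.

(** The trace of [ad X] on the derived algebra. *)
Let tr X := ip (br X e0) e0 + ip (br X e1) e1.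

Lemma br_combl (a : R) X Y Z : lie X -> lie Y -> lie Z ->
  br (a *: X + Y) Z = a *: br X Z + br Y Z.
Proof. by move=> lX lY lZ; apply: (bracket_combl sA); exact: lie_vf. Qed.

Lemma br_combr (a : R) X Y Z : lie X -> lie Y -> lie Z ->
  br Z (a *: X + Y) = a *: br Z X + br Z Y.
Proof. by move=> lX lY lZ; apply: (bracket_combr sA); exact: lie_vf. Qed.

(** By the Jacobi identity [ad] of a commutator is a commutator of endomorphisms
    of the derived algebra. *)
Lemma trace_br X Y : lie X -> lie Y -> tr (br X Y) = 0.
Proof.
move=> lX lY.
have lb U V := @lie_br U V.
have E e : dg e -> br (br X Y) e = br X (br Y e) - br Y (br X e).
  by move=> /derived_lie le; apply: (bracket_jacobi sA); exact: lie_vf.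
have F U V e e' : lie U -> lie V -> lie e -> lie e' -> ip (br U (br V e)) e' =
    ip (br V e) e0 * ip (br U e0) e' + ip (br V e) e1 * ip (br U e1) e'.
  move=> lU lV le le'.
  rewrite {1}(derived_expand (derived_br lV le)) br_combr //; last exact: lieZ.
  have -> c : br U (c *: e1) = c *: br U e1.
    have -> : c *: e1 = (c - 1) *: e1 + e1 by rewrite scalerBl scale1r subrK.
    by rewrite br_combr // scalerBl scale1r subrK.
  have l2 : lie (br U e0) by exact: lb. have l3 : lie (br U e1) by exact: lb.
  by rewrite (inner_combl rg) ?ipZl //; exact: lieZ.
have B U V e : lie U -> lie V -> lie e ->
    ip (br U (br V e) - br V (br U e)) e = ip (br U (br V e)) e - ip (br V (br U e)) e.
  move=> lU lV le; have k1 := lb _ _ lU (lb _ _ lV le).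
  have k2 := lb _ _ lV (lb _ _ lU le).
  by rewrite ipDl ?ipNl // -scaleN1r; exact: lieZ.
rewrite /tr !E // !B // !F //; ring.
Qed.

(** [ad] of a commutator is traceless on the derived algebra; expressing this for
    [e0] and [e1], which are sums of commutators, kills both coordinates of
    [[e0, e1]]. *)
Lemma derived_abelian : br e0 e1 = 0.
Proof.
have lb U V := @lie_br U V.
have tr0 Z : dg Z -> lie Z /\ tr Z = 0.
  apply: (derived_ind (Q := fun Z => lie Z /\ tr Z = 0)).
  - split; first exact: lie0.
    by have := trace_br lie0 lie0; rewrite (bracketxx A 0).
  - move=> a X Y [lX tX] [lY tY]; split; first exact: lie_algebra_comb.
    rewrite /tr !br_combl // !(inner_combl rg) //; try exact: lb.
    by rewrite addrACA -mulrDr -/(tr X) -/(tr Y) tX tY mulr0 addr0.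
  - by move=> X Y lX lY; split; [exact: lb|exact: trace_br].
have [_ t0] := tr0 _ d0; have [_ t1] := tr0 _ d1.
rewrite /tr !bracketxx !ip0l // in t0 t1.
rewrite add0r in t0; rewrite addr0 (bracketC A e0 e1) ipNl // in t1; last exact: lb.
have {}t1 := oppr_inj (etrans t1 (esym (oppr0 _))).
by rewrite (derived_expand (derived_br l0 l1)) t0 t1 !scale0r addr0.
Qed.

Lemma P_proj X : lie X -> P (X - (ip X e0 *: e0 + ip X e1 *: e1)).
Proof.
move=> lX; have lS : lie (ip X e0 *: e0 + ip X e1 *: e1).
  by apply: lie_algebra_comb => //; exact: lieZ.
have lN : lie (- (ip X e0 *: e0 + ip X e1 *: e1)) by rewrite -scaleN1r; exact: lieZ.
have lP := lieD lX lN; split => // Z dZ.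
rewrite (innerC rg) //; last exact: derived_lie.
rewrite (derived_expand dZ).
have e10 : ip e1 e0 = 0 by rewrite (innerC rg).
have P0 : ip e0 (X - (ip X e0 *: e0 + ip X e1 *: e1)) = 0.
  rewrite (innerC rg) // ipDl // ipNl // ipDl ?ipZl //; try exact: lieZ.
  by rewrite e00 e10 mulr1 mulr0 addr0 subrr.
have P1 : ip e1 (X - (ip X e0 *: e0 + ip X e1 *: e1)) = 0.
  rewrite (innerC rg) // ipDl // ipNl // ipDl ?ipZl //; try exact: lieZ.
  by rewrite e11 e01 mulr1 mulr0 add0r subrr.
by rewrite (inner_combl rg) ?ipZl ?P0 ?P1 ?mulr0 ?addr0 //; exact: lieZ.
Qed.

(** Otherwise the orthogonal complement would be central, and the derived
    algebra, being abelian, would be zero. *)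
Lemma exists_noncentral : exists u Y, [/\ P u, lie Y & br u Y <> 0].
Proof.
apply: contrapT => H.
have central u Y : P u -> lie Y -> br u Y = 0.
  by move=> Pu lY; apply: contrapT => nz; apply: H; exists u, Y.
have lb U V := @lie_br U V.
have reduce X Z : lie X -> lie Z ->
    br X Z = ip X e0 *: br e0 Z + ip X e1 *: br e1 Z.
  move=> lX lZ; have PX := P_proj lX; have lPX := P_lie PX.
  have lS : lie (ip X e0 *: e0 + ip X e1 *: e1).
    by apply: lie_algebra_comb => //; exact: lieZ.
  rewrite -{1}(subrK (ip X e0 *: e0 + ip X e1 *: e1) X) -{1}[X - _]scale1r.
  rewrite br_combl // central // scaler0 add0r br_combl //; last exact: lieZ.
  congr (_ + _); have -> c : c *: e1 = (c - 1) *: e1 + e1.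
    by rewrite scalerBl scale1r subrK.
  by rewrite br_combl // scalerBl scale1r subrK.
have c10 : br e1 e0 = 0 by rewrite bracketC derived_abelian oppr0.
have ze Z : lie Z -> br Z e0 = 0 /\ br Z e1 = 0.
  move=> lZ; rewrite !(reduce Z) // !bracketxx derived_abelian c10.
  by rewrite !scaler0 addr0.
have z X Z : lie X -> lie Z -> br X Z = 0.
  move=> lX lZ; rewrite reduce // (bracketC A Z e0) (bracketC A Z e1).
  by rewrite (ze Z lZ).1 (ze Z lZ).2 !oppr0 !scaler0 addr0.
have : e0 = 0.
  apply: (derived_ind (Q := fun Z => Z = 0)) d0 => //.
  by move=> a X Y -> ->; rewrite scaler0 addr0.
by move=> e; move: e00; rewrite e (ip0l lie0) => /eqP; rewrite eq_sym oner_eq0.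
Qed.

End OrthonormalBasis.

(** The Gram-Schmidt process on two vectors. *)
Lemma derived_orthonormal_basis : has_dimension 2 dg ->
  exists e0 e1, [/\ dg e0 /\ dg e1, ip e0 e0 = 1, ip e1 e1 = 1, ip e0 e1 = 0 &
    forall Z, dg Z -> exists a b : R, Z = a *: e0 + b *: e1].
Proof.
move=> [f [df free gen]].
pose f0 := f ord0; pose f1 := f ord_max.
have lin (a b : R) : a *: f0 + b *: f1 = 0 -> a = 0 /\ b = 0.
  move=> E; have H := free (fun i => if i == ord0 then a else b).
  have {}H : forall i, (if i == ord0 :> 'I_2 then a else b) = 0.
    apply: H; rewrite big_ord_recl big_ord1 /=.
    by rewrite (_ : lift ord0 ord0 = ord_max) //; exact: val_inj.
  by split; [exact: (H ord0)|exact: (H ord_max)].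
have d0 : dg 0.
  by exists 0, (fun=> 0), (fun=> 0), (fun=> 0); split; [case|rewrite big_ord0].
have dZ (a : R) X : dg X -> dg (a *: X).
  by move=> dX; rewrite -[_ *: _]addr0; exact: derived_comb.
have [df0 df1] : dg f0 /\ dg f1 by split; exact: df.
have normalize X : dg X -> X <> 0 -> exists2 c : R, c != 0 & ip (c *: X) (c *: X) = 1.
  move=> dX X0; have lX := derived_lie dX; have p := inner_gt0 rg lX X0.
  have s0 : Num.sqrt (ip X X) != 0 by rewrite gt_eqF // sqrtr_gt0.
  exists (Num.sqrt (ip X X))^-1; first by rewrite invr_eq0.
  rewrite ipZl ?ipZr //; last exact: lieZ.
  have ss : ip X X = Num.sqrt (ip X X) * Num.sqrt (ip X X).
    by rewrite -expr2 sqr_sqrtr // ltW.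
  by rewrite {3}ss mulKf // mulVf.
have [c0 c0n e00] : exists2 c : R, c != 0 & ip (c *: f0) (c *: f0) = 1.
  apply: normalize => // f00; have E : 1 *: f0 + 0 *: f1 = 0.
    by rewrite f00 scaler0 scale0r addr0.
  by have [/eqP] := lin _ _ E; rewrite oner_eq0.
set e0 := c0 *: f0 in e00.
have de0 : dg e0 by exact: dZ.
pose b := ip f1 e0; pose w := (- b) *: e0 + f1.
have dw : dg w by exact: derived_comb.
have w0 : w <> 0.
  move=> E; have E' : (- b * c0) *: f0 + 1 *: f1 = 0.
    by rewrite -scalerA scale1r.
  by have [_ /eqP] := lin _ _ E'; rewrite oner_eq0.
have [c1 c1n e11] := normalize w dw w0.
exists e0, (c1 *: w); split => //.
- by split => //; exact: dZ.
- have [le0 lf1] := (derived_lie de0, derived_lie df1).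
  have lw := derived_lie dw.
  rewrite ipZr // (inner_combr rg) // e00 mulr1 (innerC rg le0) // -/b addNr.
  by rewrite mulr0.
- move=> Z /gen [a ->]; rewrite big_ord_recl big_ord1.
  rewrite (_ : lift ord0 ord0 = ord_max); last exact: val_inj.
  exists (a ord0 / c0 + a ord_max * b), (a ord_max / c1).
  rewrite [(a ord_max / c1) *: _]scalerA divfK // /w scalerDr scalerDl -addrA.
  rewrite [_ *: (- b *: e0)]scalerA mulrN scaleNr [_ + (- _ + _)]addrA subrr add0r.
  by rewrite [(a ord0 / c0) *: _]scalerA divfK.
Qed.

End MetricLieAlgebra.

(** * The lifted metric on the tangent bundle *)

Section LiftedMetric.
Context {R : realType} {n : nat} (G : lieGroupType R n).
Local Notation A := (atlas : set (chart R n G)).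
Local Notation TG := (tbundle A).
Local Notation TA := (tbundle_atlas A).
Context (g : tensor2 R G) (nabla : vfield R G -> vfield R G -> vfield R G).
Context (cl vl : vfield R G -> vfield R TG) (gt : tensor2 R TG)
  (nablat : vfield R TG -> vfield R TG -> vfield R TG).
Context (rg : riemannian A g)
  (lg : left_invariant_metric A (fun x y : G => (x * y)%g) g)
  (lc : levi_civita A g nabla)
  (hcl : forall X, lie_algebra G X -> complete_lift A X (cl X))
  (hvl : forall X, lie_algebra G X -> vertical_lift A X (vl X))
  (rgt : riemannian TA gt)
  (hgt : lifted_metric g cl vl gt)
  (lct : levi_civita TA gt nablat).
Implicit Types (X Y Z D u : vfield R G) (p : G) (y : TG) (U V W : vfield R TG).
Local Notation ip := (inner g).
Local Notation br := (bracket A).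
Local Notation brt := (bracket TA).
Local Notation lie := (lie_algebra G).
Local Notation dg := (derived_algebra G).
Local Notation P := (orthogonal_complement g dg).

Let sA : smooth_atlas A := lie_smooth_atlas G.
Let sTA : smooth_atlas TA := tbundle_smooth_atlas sA.
Let lbr X Y : lie X -> lie Y -> lie (br X Y) := @lie_br _ _ _ _ _ lc X Y.
Let lnab X Y : lie X -> lie Y -> lie (nabla X Y) := @nabla_lie _ _ _ _ _ rg lg lc X Y.

Lemma cl_vf X : lie X -> vector_field TA (cl X). Proof. by move=> /hcl[]. Qed.
Lemma vl_vf X : lie X -> vector_field TA (vl X). Proof. by move=> /hvl[]. Qed.

Lemma gt_cc X Y y : lie X -> lie Y -> gt y (cl X y) (cl Y y) = ip X Y.
Proof. by move=> lX lY; have [] := hgt y lX lY. Qed.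

Lemma gt_vv X Y y : lie X -> lie Y -> gt y (vl X y) (vl Y y) = ip X Y.
Proof. by move=> lX lY; have [] := hgt y lX lY. Qed.

Lemma gt_cv X Y y : lie X -> lie Y -> gt y (cl X y) (vl Y y) = 0.
Proof. by move=> lX lY; have [] := hgt y lX lY. Qed.

Lemma gt_vc X Y y : lie X -> lie Y -> gt y (vl X y) (cl Y y) = 0.
Proof.
move=> lX lY; rewrite (metricC rgt) ?gt_cv //; apply: vf_tangent.
  exact: vl_vf.
exact: cl_vf.
Qed.

Lemma br_cc X Y : lie X -> lie Y -> brt (cl X) (cl Y) = cl (br X Y).
Proof.
move=> lX lY; apply: (complete_lift_bracket sA (lie_vf lX) (lie_vf lY)).
- by apply: (bracket_vf sTA lct); exact: cl_vf.
- exact: hcl.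
- exact: hcl.
- by apply: hcl; exact: lbr.
Qed.

Lemma br_cv X Y : lie X -> lie Y -> brt (cl X) (vl Y) = vl (br X Y).
Proof.
move=> lX lY; apply: (mixed_lift_bracket sA (lie_vf lX) (lie_vf lY)).
- by apply: (bracket_vf sTA lct); [exact: cl_vf|exact: vl_vf].
- exact: hcl.
- exact: hvl.
- by apply: hvl; exact: lbr.
Qed.

Lemma br_vc X Y : lie X -> lie Y -> brt (vl X) (cl Y) = - vl (br Y X).
Proof. by move=> lX lY; rewrite bracketC br_cv. Qed.

Lemma br_vv X Y : lie X -> lie Y -> brt (vl X) (vl Y) = 0.
Proof.
move=> lX lY; apply: (vertical_lift_bracket sA (lie_vf lX) (lie_vf lY)).
- by apply: (bracket_vf sTA lct); exact: vl_vf.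
- exact: hvl.
- exact: hvl.
Qed.

(** D has the components of the projection of w to G, so that [w - cl D y] is
    vertical, and D' has the components of this vertical vector. *)
Lemma lift_span y w : tangent TA y w ->
  exists D D', [/\ lie D, lie D' & w = cl D y + vl D' y].
Proof.
move=> tw; have [a Aa ay] := atlas_cover sA (foot y).
have mA : manifold A := atlas_manifold.
have cfc (xi : 'rV[R]_n) : exists2 D, lie D &
    forall i, D (foot y) (fun q => coord a q ord0 i) = xi ord0 i.
  have [v [tv vE]] := tangent_exists mA xi Aa ay.
  have [D lD Dv] := lie_algebra_span tv; exists D => // i.
  rewrite Dv (vE _ _ (represents_coord a (foot y) i)).
  have := @derive_rV _ _ _ id (coord a (foot y)) xi
    (differentiable_rV (fun i => differentiable_coord _ ord0 i)).
  by rewrite derive_id => /rowP/(_ i); rewrite mxE.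
have [D lD DE] := cfc (\row_i w ((fun q => coord a q ord0 i) \o @foot _ _ _ A)).
have [D' lD' DE'] := cfc (\row_i (w (fun z => vec z (fun q => coord a q ord0 i))
   - vec y (fun q => D q (fun q => coord a q ord0 i)))).
have tc := vf_tangent y (cl_vf lD); have tv := vf_tangent y (vl_vf lD').
exists D, D'; split => //; apply: (tbundle_tangent_eq sA Aa ay tw).
- by rewrite -[cl D y]scale1r; apply: (tangent_comb sTA).
- move=> i f; have sf : smooth_at A (foot y) f := smooth_at_coord i Aa ay.
  rewrite !fctE (complete_lift_foot sA (hcl lD) sf).
  by rewrite (vertical_lift_foot (hvl lD') sf) addr0 DE mxE.
- move=> i f; have sf : smooth_at A (foot y) f := smooth_at_coord i Aa ay.
  rewrite !fctE (complete_lift_vec sA (hcl lD) sf).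
  rewrite (vertical_lift_vec sA (hvl lD') sf) DE' mxE.
  by rewrite addrC subrK.
Qed.

(** The lifts to which [v - w] is orthogonal span the tangent space, so it is
    orthogonal to itself. *)
Lemma gt_eq y v w : tangent TA y v -> tangent TA y w ->
  (forall Z, lie Z -> gt y v (cl Z y) = gt y w (cl Z y)) ->
  (forall Z, lie Z -> gt y v (vl Z y) = gt y w (vl Z y)) -> v = w.
Proof.
move=> tv tw vc vv; apply: contrapT => nvw.
have tD := tangentB sTA tv tw.
have := metric_gt0 rgt tD _; have nz : v - w <> 0.
  by move=> /eqP; rewrite subr_eq0 => /eqP.
move=> /(_ nz); have [D [D' [lD lD' E]]] := lift_span tD.
have tc := vf_tangent y (cl_vf lD); have tl := vf_tangent y (vl_vf lD').
have tE : tangent TA y (cl D y + vl D' y) by rewrite -E.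
have [bgt _ _ _] := rgt.
rewrite {1}E -[cl D y]scale1r bgt // mul1r (metricC rgt tc tD) (metricC rgt tl tD).
rewrite (metricB rgt tv tw tc) (metricB rgt tv tw tl) vc // vv //.
by rewrite !subrr addr0 ltxx.
Qed.

Lemma gt_const_cc X Y : lie X -> lie Y -> constant_inner gt (cl X) (cl Y).
Proof. by move=> lX lY p q; rewrite !gt_cc. Qed.
Lemma gt_const_vv X Y : lie X -> lie Y -> constant_inner gt (vl X) (vl Y).
Proof. by move=> lX lY p q; rewrite !gt_vv. Qed.
Lemma gt_const_cv X Y : lie X -> lie Y -> constant_inner gt (cl X) (vl Y).
Proof. by move=> lX lY p q; rewrite !gt_cv. Qed.
Lemma gt_const_vc X Y : lie X -> lie Y -> constant_inner gt (vl X) (cl Y).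
Proof. by move=> lX lY p q; rewrite !gt_vc. Qed.

Lemma gtNl y v w : tangent TA y v -> tangent TA y w -> gt y (- v) w = - gt y v w.
Proof.
move=> tv tw; have := metricB rgt (tangentB sTA tv tv) tv tw.
by rewrite (metricB rgt tv tv tw) !subrr !sub0r.
Qed.

Lemma gt0l y w : tangent TA y w -> gt y 0 w = 0.
Proof. by move=> tw; have := metricB rgt tw tw tw; rewrite !subrr. Qed.

Ltac lifts := solve [ assumption | exact: cl_vf | exact: vl_vf | exact: gt_const_cc
  | exact: gt_const_vv | exact: gt_const_cv | exact: gt_const_vc
  | apply: vf_tangent; solve [exact: cl_vf | exact: vl_vf ] ].

(** Koszul's formula for the eight combinations of lifts: the suffix cvv means
    that it is applied to [cl X], [vl Y], [vl Z], and so on. *)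
Lemma koszul_ccc X Y Z y : lie X -> lie Y -> lie Z ->
  2 * gt y (nablat (cl X) (cl Y) y) (cl Z y) =
  ip (br X Y) Z - ip (br Y Z) X + ip (br Z X) Y.
Proof.
move=> lX lY lZ; rewrite (koszul sTA rgt lct); try lifts.
by rewrite !br_cc // !gt_cc //; exact: lbr.
Qed.

Lemma koszul_ccv X Y Z y : lie X -> lie Y -> lie Z ->
  2 * gt y (nablat (cl X) (cl Y) y) (vl Z y) = 0.
Proof.
move=> lX lY lZ; rewrite (koszul sTA rgt lct); try lifts.
have l1 := lbr lX lY; have l2 := lbr lY lZ; have l3 := lbr lX lZ.
rewrite br_cc // !br_cv // br_vc // !fctE gtNl; try lifts.
by rewrite gt_cv // !gt_vc // subrr oppr0 addr0.
Qed.

Lemma koszul_vvc X Y Z y : lie X -> lie Y -> lie Z ->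
  2 * gt y (nablat (vl X) (vl Y) y) (cl Z y) = ip (br Z Y) X + ip (br Z X) Y.
Proof.
move=> lX lY lZ; rewrite (koszul sTA rgt lct); try lifts.
have l1 := lbr lZ lX; have l2 := lbr lZ lY.
rewrite br_vv // br_vc // br_cv // !fctE gt0l ?gtNl; try lifts.
by rewrite !gt_vv // sub0r opprK.
Qed.

Lemma koszul_vvv X Y Z y : lie X -> lie Y -> lie Z ->
  2 * gt y (nablat (vl X) (vl Y) y) (vl Z y) = 0.
Proof.
move=> lX lY lZ; rewrite (koszul sTA rgt lct); try lifts.
by rewrite !br_vv // !gt0l ?subrr ?addr0 //; lifts.
Qed.

Lemma koszul_cvv X Y Z y : lie X -> lie Y -> lie Z ->
  2 * gt y (nablat (cl X) (vl Y) y) (vl Z y) = ip (br X Y) Z - ip (br X Z) Y.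
Proof.
move=> lX lY lZ; rewrite (koszul sTA rgt lct); try lifts.
have l1 := lbr lX lY; have l2 := lbr lX lZ.
rewrite br_vv // br_vc // br_cv // !fctE gt0l ?gtNl; try lifts.
by rewrite !gt_vv // subr0.
Qed.

Lemma koszul_cvc X Y Z y : lie X -> lie Y -> lie Z ->
  2 * gt y (nablat (cl X) (vl Y) y) (cl Z y) = 0.
Proof.
move=> lX lY lZ; rewrite (koszul sTA rgt lct); try lifts.
have l1 := lbr lX lY; have l2 := lbr lZ lY; have l3 := lbr lZ lX.
rewrite br_cv // br_vc // br_cc // !fctE gtNl; try lifts.
by rewrite gt_cv // !gt_vc // oppr0 subr0 addr0.
Qed.

Lemma koszul_vcv X Y Z y : lie X -> lie Y -> lie Z ->
  2 * gt y (nablat (vl X) (cl Y) y) (vl Z y) = - ip (br Y X) Z - ip (br Y Z) X.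
Proof.
move=> lX lY lZ; rewrite (koszul sTA rgt lct); try lifts.
have l1 := lbr lY lX; have l2 := lbr lY lZ.
rewrite br_vv // br_vc // br_cv // !fctE gt0l ?gtNl; try lifts.
by rewrite !gt_vv // addr0.
Qed.

Lemma koszul_vcc X Y Z y : lie X -> lie Y -> lie Z ->
  2 * gt y (nablat (vl X) (cl Y) y) (cl Z y) = 0.
Proof.
move=> lX lY lZ; rewrite (koszul sTA rgt lct); try lifts.
have l1 := lbr lY lX; have l2 := lbr lY lZ; have l3 := lbr lZ lX.
rewrite br_cv // br_vc // br_cc // !fctE gtNl; try lifts.
by rewrite gt_cv // !gt_vc // oppr0 !addr0.
Qed.

Lemma mul2I (a b : R) : 2 * a = 2 * b -> a = b.
Proof. by apply: mulfI; rewrite pnatr_eq0. Qed.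

Lemma mul2_eq0 (a : R) : 2 * a = 0 -> a = 0.
Proof. by move=> H; apply: mul2I; rewrite mulr0. Qed.

Lemma eq_cl W D : vector_field TA W -> lie D ->
  (forall y Z, lie Z -> 2 * gt y (W y) (cl Z y) = 2 * ip D Z) ->
  (forall y Z, lie Z -> 2 * gt y (W y) (vl Z y) = 0) -> W = cl D.
Proof.
move=> vW lD Wc Wv; apply/funext => y.
apply: gt_eq; [exact: vf_tangent|exact/vf_tangent/cl_vf| |] => Z lZ.
  by rewrite gt_cc //; apply: mul2I; exact: Wc.
by rewrite gt_cv //; apply: mul2_eq0; exact: Wv.
Qed.

Lemma eq_vl W D : vector_field TA W -> lie D ->
  (forall y Z, lie Z -> 2 * gt y (W y) (cl Z y) = 0) ->
  (forall y Z, lie Z -> 2 * gt y (W y) (vl Z y) = 2 * ip D Z) -> W = vl D.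
Proof.
move=> vW lD Wc Wv; apply/funext => y.
apply: gt_eq; [exact: vf_tangent|exact/vf_tangent/vl_vf| |] => Z lZ.
  by rewrite gt_vc //; apply: mul2_eq0; exact: Wc.
by rewrite gt_vv //; apply: mul2I; exact: Wv.
Qed.

Let nab_vf U V : vector_field TA U -> vector_field TA V -> vector_field TA (nablat U V).
Proof. by move=> vU vV; exact: (nabla_vf lct vU vV). Qed.

Lemma nabla_cc X Y : lie X -> lie Y -> nablat (cl X) (cl Y) = cl (nabla X Y).
Proof.
move=> lX lY; apply: eq_cl; [by apply: nab_vf; exact: cl_vf|exact: lnab| |] => y Z lZ.
  by rewrite koszul_ccc // (koszul_lie rg lg lc).
exact: koszul_ccv.
Qed.

Lemma ip_brC X Y Z : lie X -> lie Y -> lie Z -> ip (br X Y) Z = - ip (br Y X) Z.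
Proof.
by move=> lX lY lZ; rewrite bracketC (ipNl rg) //; exact: lbr.
Qed.

Lemma nabla_vv X Y : lie X -> lie Y -> br X Y = 0 ->
  nablat (vl X) (vl Y) = cl (nabla X Y).
Proof.
move=> lX lY XY; apply: eq_cl; [by apply: nab_vf; exact: vl_vf|exact: lnab| |] => y Z lZ.
  rewrite koszul_vvc // (koszul_lie rg lg lc) // XY (ip0l rg) // sub0r.
  by rewrite (ip_brC lZ lY lX).
exact: koszul_vvv.
Qed.

(** For general X in place of u, Koszul's formula on G has one more term,
    [- ip (br Y Z) X], which vanishes when X is orthogonal to the derived
    algebra. *)
Lemma nabla_cPv u Y : P u -> lie Y -> nablat (cl u) (vl Y) = vl (nabla u Y).
Proof.
move=> Pu lY; have lu := P_lie Pu.
apply: eq_vl; [by apply: nab_vf; [exact: cl_vf|exact: vl_vf]|exact: lnab| |] => y Z lZ.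
  exact: koszul_cvc.
rewrite koszul_cvv // (koszul_lie rg lg lc) // (P_br rg lc Pu lY lZ) subr0.
by rewrite (ip_brC lZ lu lY).
Qed.

Lemma nabla_vcP u Y : P u -> lie Y -> nablat (vl Y) (cl u) = vl (nabla Y u).
Proof.
move=> Pu lY; have lu := P_lie Pu.
apply: eq_vl; [by apply: nab_vf; [exact: vl_vf|exact: cl_vf]|exact: lnab| |] => y Z lZ.
  exact: koszul_vcc.
rewrite koszul_vcv // (koszul_lie rg lg lc) // (P_br rg lc Pu lZ lY) addr0.
by rewrite (ip_brC lY lu lZ).
Qed.

(** Among the two terms of Koszul's formula only the one with the bracket of Y
    and u survives, the other being an inner product of u with a bracket. *)
Lemma nabla_vPc u Y : P u -> lie Y ->
  nablat (vl u) (cl Y) = vl (- (2^-1) *: br Y u).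
Proof.
move=> Pu lY; have lu := P_lie Pu; have lB := lbr lY lu; have lD := lieZ (- (2^-1)) lB.
apply: eq_vl => // [|y Z lZ|y Z lZ].
- by apply: nab_vf; [exact: vl_vf|exact: cl_vf].
- exact: koszul_vcc.
- rewrite koszul_vcv // (P_br rg lc Pu lY lZ) subr0 (ipZl rg) // mulNr mulrN mulrA.
  by rewrite divff ?pnatr_eq0 // mul1r.
Qed.

Lemma nabla_cvP u Y : P u -> lie Y ->
  nablat (cl Y) (vl u) = vl (2^-1 *: br Y u).
Proof.
move=> Pu lY; have lu := P_lie Pu; have lB := lbr lY lu; have lD := lieZ (2^-1) lB.
apply: eq_vl => // [|y Z lZ|y Z lZ].
- by apply: nab_vf; [exact: cl_vf|exact: vl_vf].
- exact: koszul_cvc.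
- rewrite koszul_cvv // (P_br rg lc Pu lY lZ) subr0 (ipZl rg) // mulrA.
  by rewrite divff ?pnatr_eq0 // mul1r.
Qed.

(** * Curvatures of planes spanned by lifts *)

Local Notation num U V y := (gt y (curvature TA nablat U V V y) (U y)).
Local Notation num0 X Y p := (g p (curvature A nabla X Y Y p) (X p)).

Lemma curvature_cc X Y y p : lie X -> lie Y -> num (cl X) (cl Y) y = num0 X Y p.
Proof.
move=> lX lY; rewrite (curvature_lie rg lg lc) //.
have l1 := lnab lY lY; have l2 := lnab lX lY; have l3 := lbr lX lY.
rewrite (curvature_inner sTA rgt lct) ?nabla_cc ?br_cc //; try lifts.
by rewrite ?nabla_cc // !gt_cc //; exact: lnab.
Qed.

(** All the covariant derivatives in [curvature_inner] are lifts of those on G,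
    except the one along [vl (br u Y)], whose inner product with [cl u] is
    nevertheless that of G, again because u is orthogonal to the derived
    algebra. *)
Lemma curvature_cv u Y y p : P u -> lie Y -> num (cl u) (vl Y) y = num0 u Y p.
Proof.
move=> Pu lY; have lu := P_lie Pu; rewrite (curvature_lie rg lg lc) //.
have l1 := lnab lY lY; have l2 := lnab lu lY; have l3 := lbr lu lY.
have l4 := lnab lY lu; have l5 := lnab lu lu.
rewrite (curvature_inner sTA rgt lct) ?nabla_vv ?nabla_cPv ?bracketxx //; try lifts.
rewrite nabla_vcP // nabla_cc // br_cv // gt_cc // gt_vv //; congr (_ - _).
apply: mul2I; rewrite koszul_vvc // (koszul_lie rg lg lc) // (P_br rg lc Pu l3 lY).
by rewrite sub0r (ip_brC lY lu l3) opprK.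
Qed.

(** When X and Y commute, the derivatives of vertical lifts are the complete
    lifts of the derivatives on G, and the term in the bracket is absent from
    both curvatures. *)
Lemma curvature_vv X Y y p : lie X -> lie Y -> br X Y = 0 ->
  num (vl X) (vl Y) y = num0 X Y p.
Proof.
move=> lX lY XY; rewrite (curvature_lie rg lg lc) // XY (nabla0l sA lc (lie_vf lY)).
have YX : br Y X = 0 by rewrite bracketC XY oppr0.
have l1 := lnab lY lY; have l2 := lnab lX lY; have l3 := lnab lX lX.
have l4 := lnab lY lX.
rewrite (curvature_inner sTA rgt lct) ?nabla_vv ?bracketxx //; try lifts.
rewrite br_vv // (nabla0l sTA lct (vl_vf lY)) !gt_cc // gt0l ?(ip0l rg) //.
by lifts.
Qed.

Lemma sec_cc X Y y p : lie X -> lie Y -> sec TA gt nablat (cl X) (cl Y) y = sec A g nabla X Y p.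
Proof.
move=> lX lY; rewrite /sec (curvature_cc _ p) // !gt_cc //.
by rewrite (inner_at lg p lX lX) (inner_at lg p lY lY) (inner_at lg p lX lY).
Qed.

Lemma sec_cv u Y y p : P u -> lie Y -> ip u Y = 0 ->
  sec TA gt nablat (cl u) (vl Y) y = sec A g nabla u Y p.
Proof.
move=> Pu lY uY; have lu := P_lie Pu.
rewrite /sec (curvature_cv _ p) // gt_cc // gt_vv // gt_cv //.
by rewrite (inner_at lg p lu lu) (inner_at lg p lY lY) (inner_at lg p lu lY) uY.
Qed.

Lemma sec_vv X Y y p : lie X -> lie Y -> br X Y = 0 ->
  sec TA gt nablat (vl X) (vl Y) y = sec A g nabla X Y p.
Proof.
move=> lX lY XY; rewrite /sec (curvature_vv _ p) // !gt_vv //.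
by rewrite (inner_at lg p lX lX) (inner_at lg p lY lY) (inner_at lg p lX lY).
Qed.

(** Nonzero orthogonal vectors are independent and their Gram determinant is the
    product of their square norms. *)
Lemma sectional_curvature_orthogonal U V y : vector_field TA U -> vector_field TA V ->
  gt y (U y) (V y) = 0 -> 0 < gt y (U y) (U y) -> 0 < gt y (V y) (V y) ->
  sectional_curvatures TA gt nablat y
    (num U V y / (gt y (U y) (U y) * gt y (V y) (V y))).
Proof.
move=> vU vV UV UU VV; exists U, V; split => //; last first.
  by rewrite /sec UV expr0n subr0.
have [tU tV] := (vf_tangent y vU, vf_tangent y vV).
have [bgt _ _ _] := rgt.
have gZ (t : R) v w : tangent TA y v -> tangent TA y w -> gt y (t *: v) w = t * gt y v w.
  move=> tv tw; have t0 : tangent TA y 0 by rewrite -(subrr v); exact: (tangentB sTA).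
  by rewrite -[t *: v]addr0 bgt // gt0l // addr0.
move=> s t E.
have tZ : tangent TA y (t *: V y).
  have t0 : tangent TA y 0 by rewrite -(subrr (V y)); exact: (tangentB sTA).
  by rewrite -[t *: _]addr0; exact: (tangent_comb sTA).
have e1 : gt y (s *: U y + t *: V y) (U y) = s * gt y (U y) (U y).
  by rewrite bgt // gZ // (metricC rgt tV tU) UV mulr0 addr0.
have e2 : gt y (s *: U y + t *: V y) (V y) = t * gt y (V y) (V y).
  by rewrite bgt // gZ // UV mulr0 add0r.
rewrite E gt0l // in e1; rewrite E gt0l // in e2.
split; apply/eqP.
  by move/esym/eqP: e1; rewrite mulf_eq0 (gt_eqF UU) orbF.
by move/esym/eqP: e2; rewrite mulf_eq0 (gt_eqF VV) orbF.
Qed.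

Section ThreeSigns.
Context (u Y : vfield R G) (Pu : P u) (lY : lie Y) (uY : br Y u <> 0).
Let lu := P_lie Pu.
Let E := br Y u.
Let lE : lie E := lbr lY lu.

Let EE : 0 < ip E E.
Proof. exact: (inner_gt0 rg lE uY). Qed.

Let uu : 0 < ip u u.
Proof.
apply: (inner_gt0 rg lu) => u0; apply: uY; rewrite u0.
have := bracket_combr sA (-1) (lie_vf lu) (lie_vf lu) (lie_vf lY).
by rewrite u0 scaleN1r addNr => ->; rewrite scaleN1r addNr.
Qed.

Let YY : 0 < ip Y Y.
Proof.
apply: (inner_gt0 rg lY) => Y0; apply: uY; rewrite Y0.
have := bracket_combl sA (-1) (lie_vf lY) (lie_vf lY) (lie_vf lu).
by rewrite Y0 scaleN1r addNr => ->; rewrite scaleN1r addNr.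
Qed.

(** On the plane of [cl u] and [vl u] the numerator is that of the degenerate
    pair (u, u) on G. *)
Lemma zero_curvature y : sectional_curvatures TA gt nablat y 0.
Proof.
have := @sectional_curvature_orthogonal (cl u) (vl u) y (cl_vf lu) (vl_vf lu).
rewrite gt_cv // gt_cc // gt_vv // (curvature_cv _ 1%g) // => /(_ erefl uu uu).
rewrite (curvature_lie rg lg lc) // (nabla_P rg lg lc Pu) bracketxx.
rewrite (nabla0l sA lc (lie_vf lu)) !(ip0l rg) //; try exact: lie0.
by rewrite oppr0 !addr0 mul0r.
Qed.

(** The numerator is -3/4 |[Y, u]|^2. *)
Lemma negative_curvature y :
  exists2 k, sectional_curvatures TA gt nablat y k & k < 0.
Proof.
have := @sectional_curvature_orthogonal (cl Y) (vl u) y (cl_vf lY) (vl_vf lu).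
rewrite gt_cv // gt_cc // gt_vv // => /(_ erefl YY uu) H; eexists; first exact: H.
rewrite pmulr_llt0 ?invr_gt0 ?mulr_gt0 //.
have l1 := lnab lu lu; have l2 := lieZ (2^-1) lE; have l3 := lieZ (- (2^-1)) lE.
have l4 := lnab lY lY.
rewrite (curvature_inner sTA rgt lct) ?nabla_vv ?nabla_cvP ?bracketxx //; try lifts.
rewrite nabla_vPc // nabla_cc // br_cv // gt_cc // gt_vv //.
rewrite (nabla_P rg lg lc Pu) (ip0l rg) // (ipZl rg) // (ipZr rg) //.
have : 2 * gt y (nablat (vl E) (vl u) y) (cl Y y) = ip E E.
  by rewrite koszul_vvc // (P_br rg lc Pu lY lE) addr0.
move: (gt y _ _) EE => a; rewrite -/E; move: (ip E E) => b.
move=> b0 ab; have -> : a = 2^-1 * b by rewrite -ab mulrA mulVf ?mul1r ?pnatr_eq0.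
by lra.
Qed.

(** The numerator is the square norm of the covariant derivative of [vl E] along
    [vl u], which has inner product 1/2 |E|^2 with [cl Y], for E = [Y, u]. *)
Lemma positive_curvature y :
  exists2 k, sectional_curvatures TA gt nablat y k & 0 < k.
Proof.
have uE : ip u E = 0 by rewrite (innerC rg lu lE) (P_br rg lc Pu lY lu).
have := @sectional_curvature_orthogonal (vl u) (vl E) y (vl_vf lu) (vl_vf lE).
rewrite !gt_vv // => /(_ uE uu EE) H; eexists; first exact: H.
rewrite pmulr_lgt0 ?invr_gt0 ?mulr_gt0 //.
have l1 := lnab lE lE; have l2 := lnab lu lu.
have cuE : constant_inner gt (nablat (vl u) (vl E)) (vl u).
  by move=> p q; apply: mul2I; rewrite !koszul_vvv.
have nEE := nabla_vv lE lE (bracketxx A E).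
have nuu := nabla_vv lu lu (bracketxx A u).
have cEE : constant_inner gt (nablat (vl E) (vl E)) (vl u) by rewrite nEE; lifts.
rewrite (curvature_inner sTA rgt lct _ (vl_vf lu) (vl_vf lE) cEE cuE) nEE nuu gt_cc //.
rewrite (nabla_P rg lg lc Pu).
have -> : ip (nabla E E) 0 = 0 by rewrite (innerC rg) ?(ip0l rg) //; exact: lie0.
rewrite br_vv // (nabla0l sTA lct (vl_vf lE)) gt0l; last by lifts.
rewrite oppr0 add0r addr0.
have vW := nab_vf (vl_vf lu) (vl_vf lE); have vW' := nab_vf (vl_vf lE) (vl_vf lu).
have -> : nablat (vl E) (vl u) = nablat (vl u) (vl E).
  apply/esym/eqP; rewrite -subr_eq0; apply/eqP.
  by rewrite (nabla_torsion lct) ?br_vv //; exact: vl_vf.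
apply: (metric_gt0 rgt); first exact: vf_tangent.
move=> W0; have := koszul_vvc y lu lE lY; rewrite W0 gt0l; last by lifts.
rewrite mulr0 (P_br rg lc Pu lY lE) add0r => e.
by move: EE; rewrite /E -e ltxx.
Qed.

End ThreeSigns.

End LiftedMetric.

Theorem corollary3p3 (R : realType) (n : nat) (G : lieGroupType R n)
    (A := (atlas : set (chart R n G))) (TG := tbundle A)
    (TA := tbundle_atlas A)
    (g : tensor2 R G)
    (nabla : vfield R G -> vfield R G -> vfield R G)
    (cl vl : vfield R G -> vfield R TG)
    (gt : tensor2 R TG)
    (nablat : vfield R TG -> vfield R TG -> vfield R TG)
    (G_connected : connected [set: G])
    (dim_derived : has_dimension 2 (derived_algebra G))
    (g_riemannian : riemannian A g)
    (g_left_invariant : left_invariant_metric A (fun x y : G => (x * y)%g) g)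
    (nabla_lc : levi_civita A g nabla)
    (cl_lift : forall X, lie_algebra G X -> complete_lift A X (cl X))
    (vl_lift : forall X, lie_algebra G X -> vertical_lift A X (vl X))
    (gt_riemannian : riemannian TA gt)
    (gt_left_invariant : left_invariant_metric TA (@tmul R n G) gt)
    (gt_lifted : lifted_metric g cl vl gt)
    (nablat_lc : levi_civita TA gt nablat)
    (K := sec A g nabla) (Kt := sec TA gt nablat) :
  (forall y : TG,
    [/\ exists2 k, sectional_curvatures TA gt nablat y k & 0 < k,
        exists2 k, sectional_curvatures TA gt nablat y k & k < 0 &
        sectional_curvatures TA gt nablat y 0]) /\
  (forall e : 'I_2 -> vfield R G,
    basis_of_set (derived_algebra G) e ->
    (forall i j, inner g (e i) (e j) = (i == j)%:R) ->
    forall u v,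
    orthogonal_complement g (derived_algebra G) u ->
    orthogonal_complement g (derived_algebra G) v ->
    orthonormal_pair g u v ->
    forall (y : TG) (p : G),
    [/\ forall i, Kt (cl u) (cl (e i)) y = K u (e i) p /\
                  Kt (cl u) (vl (e i)) y = K u (e i) p,
        Kt (cl (e ord0)) (cl (e ord_max)) y = K (e ord0) (e ord_max) p /\
        Kt (vl (e ord0)) (vl (e ord_max)) y = K (e ord0) (e ord_max) p &
        Kt (cl u) (cl v) y = K u v p /\ Kt (cl u) (vl v) y = K u v p]).
Proof.
split=> [y|e [de _ spane] oe u v Pu Pv [_ _ uv] y p].
  have [e0 [e1 [[d0 d1] e00 e11 e01 span]]] :=
    derived_orthonormal_basis g_riemannian nabla_lc dim_derived.
  have [u [Y [Pu lY uY]]] :=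
    exists_noncentral g_riemannian nabla_lc d0 d1 e00 e11 e01 span.
  have Yu : bracket A Y u <> 0.
    by move=> Yu; apply: uY; rewrite bracketC Yu oppr0.
  split.
  - exact: (positive_curvature g_riemannian g_left_invariant nabla_lc cl_lift
      vl_lift gt_riemannian gt_lifted nablat_lc Pu lY Yu).
  - exact: (negative_curvature g_riemannian g_left_invariant nabla_lc cl_lift
      vl_lift gt_riemannian gt_lifted nablat_lc Pu lY Yu).
  - exact: (zero_curvature g_riemannian g_left_invariant nabla_lc cl_lift
      vl_lift gt_riemannian gt_lifted nablat_lc Pu lY Yu).
have le i : lie_algebra G (e i) by exact: (derived_lie nabla_lc).
have [lu lv] := (P_lie Pu, P_lie Pv).
have cc := sec_cc g_riemannian g_left_invariant nabla_lc cl_lift vl_lift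
  gt_riemannian gt_lifted nablat_lc.
have cv := sec_cv g_riemannian g_left_invariant nabla_lc cl_lift vl_lift
  gt_riemannian gt_lifted nablat_lc.
have vv := sec_vv g_riemannian g_left_invariant nabla_lc cl_lift vl_lift
  gt_riemannian gt_lifted nablat_lc.
have ab : bracket A (e ord0) (e ord_max) = 0.
  apply: (derived_abelian g_riemannian nabla_lc (de ord0) (de ord_max));
    rewrite ?oe // => Z /spane [a ->]; exists (a ord0), (a ord_max).
  rewrite big_ord_recl big_ord1 (_ : lift ord0 ord0 = ord_max) //; exact: val_inj.
split=> [i||].
- by split; [exact: cc|apply: cv => //; exact: (Pu.2 _ (de i))].
- by split; [exact: cc|exact: vv].
- by split; [exact: cc|exact: cv].
Qed.
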